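(* Let $p\in C^{0,1}(\mathbb{R}^N)$ and $q\in L^\infty(\mathbb{R}^N)$ satisfy $1\ll q\ll p\ll N$. Assume that $V\in C(\mathbb{R}^N)$, $V_->0$, and $V^{-q(\cdot)/(p(\cdot)-q(\cdot))}\in L^1(\mathbb{R}^N)$. Then there is a continuous and compact embedding $X\hookrightarrow L^{q(x)}(\mathbb{R}^N)$.
   Context: For functions $a,b:\mathbb{R}^N\to\mathbb{R}$, $a\ll b$ means $\inf_{\mathbb{R}^N}(b-a)>0$; $a_-=\inf_{\mathbb{R}^N}a$ and $a_+=\sup_{\mathbb{R}^N}a$ (essential infimum/supremum for functions in $L^\infty$). $C^{0,1}(\mathbb{R}^N)$ denotes Lipschitz continuous functions. For $r\in L^\infty(\mathbb{R}^N)$, $r\ge1$, $L^{r(x)}(\mathbb{R}^N)$ is the space of measurable $u:\mathbb{R}^N\to\mathbb{R}$ with $\int|u|^{r(x)}<\infty$, with the Luxemburg norm $|u|_{r(x)}=\inf\{\xi>0:\int|u/\xi|^{r(x)}\le1\}$. $X$ is the completion of $C_0^\infty(\mathbb{R}^N)$ (smooth compactly supported functions) with respect to the norm $$\|u\|=\inf\left\{\xi>0:\int_{\mathbb{R}^N}\left(\left|\frac{\nabla u}{\xi}\right|^{p(x)}+V(x)\left|\frac{u}{\xi}\right|^{p(x)}\right)dx\le1\right\}.$$ Since $V_->0$, $X$ is continuously embedded in $W^{1,p(x)}(\mathbb{R}^N)$, the completion of $C_0^\infty(\mathbb{R}^N)$ with respect to $|u|_{p(x)}+|\nabla u|_{p(x)}$;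 elements of $X$ are thus identified with functions on $\mathbb{R}^N$. *)

(* Defs.v *)
From HB Require Import structures.
From mathcomp Require Import all_boot all_order all_algebra.
From mathcomp Require Import all_classical all_reals all_analysis ess_sup_inf.

Set Implicit Arguments.
Unset Strict Implicit.
Unset Printing Implicit Defensive.

Import Order.TTheory GRing.Theory Num.Theory.
Import numFieldNormedType.Exports.

Local Open Scope classical_set_scope.
Local Open Scope ring_scope.

(* The sigma-algebra on 'rV[R]_n is generated by the coordinates, that is, the
   Borel sigma-algebra of R^n. *)

Definition rV_display : measure_display.
Proof. exact: default_measure_display. Qed.

Section measurable_rV.
Context {R : realType} (n : nat).

Definition rV_coord (i : 'I_n) (v : 'rV[R]_n) : R := v ord0 i.

Let rV_set0 : g_sigma_preimage rV_coord set0.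
Proof. exact: sigma_algebra0. Qed.

Let rV_setC A : g_sigma_preimage rV_coord A -> g_sigma_preimage rV_coord (~` A).
Proof. exact: sigma_algebraC. Qed.

Let rV_bigcup (F : (set 'rV[R]_n)^nat) :
  (forall i, g_sigma_preimage rV_coord (F i)) ->
  g_sigma_preimage rV_coord (\bigcup_i (F i)).
Proof. exact: sigma_algebra_bigcup. Qed.

HB.instance Definition _ := @isMeasurable.Build rV_display
  'rV[R]_n (g_sigma_preimage rV_coord) rV_set0 rV_setC rV_bigcup.

End measurable_rV.

Section measurable_rV_theory.
Context {R : realType}.

Lemma measurable_rV_coord n (i : 'I_n) :
  measurable_fun [set: 'rV[R]_n] (fun v : 'rV[R]_n => v ord0 i).
Proof.
move=> _ Y mY; rewrite setTI; apply: sub_sigma_algebra => /=.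
rewrite -bigcup_seq/=; exists i => /=; first by rewrite mem_index_enum.
by exists Y => //; rewrite setTI.
Qed.

Lemma measurable_fun_rVP d (T : measurableType d) n (f : T -> 'rV[R]_n) :
  (forall i, measurable_fun [set: T] (fun x => f x ord0 i)) ->
  measurable_fun [set: T] f.
Proof.
move=> mf _ A mA; rewrite setTI; move: A mA.
apply: smallest_sub.
  split=> [|A mA|F mF]; first by rewrite preimage_set0.
    by rewrite setTD preimage_setC; exact: measurableC.
  by rewrite preimage_bigcup; exact: bigcup_measurable.
move=> A; rewrite -bigcup_seq => -[i _ [B mB <-]].
by rewrite setTI; have := mf i measurableT B mB; rewrite setTI.
Qed.

Definition rV_cons n (x : R * 'rV[R]_n) : 'rV[R]_n.+1 :=
  row_mx (x.1%:M : 'rV_1) x.2.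

Definition rV_uncons n (v : 'rV[R]_n.+1) : R * 'rV[R]_n :=
  (v ord0 ord0, \row_i v ord0 (lift ord0 i)).

Lemma rV_cons0 n (x : R * 'rV[R]_n) : rV_cons x ord0 ord0 = x.1.
Proof.
rewrite mxE; case: splitP => [j _|j /= /eqP]; last by rewrite eq_sym.
by rewrite (ord1 j) mxE eqxx.
Qed.

Lemma rV_cons_lift n (x : R * 'rV[R]_n) i :
  rV_cons x ord0 (lift ord0 i) = x.2 ord0 i.
Proof.
rewrite mxE; case: splitP => [j|j /= ij]; first by rewrite ord1.
by congr (_ _ _); apply: val_inj; apply/eqP; rewrite -(eqn_add2l 1) -ij.
Qed.

Lemma rV_consK n : cancel (@rV_cons n) (@rV_uncons n).
Proof.
case=> a v; congr pair; first exact: rV_cons0.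
by apply/rowP => i; rewrite mxE rV_cons_lift.
Qed.

Lemma rV_unconsK n : cancel (@rV_uncons n) (@rV_cons n).
Proof.
move=> v; apply/rowP => i; case: (unliftP ord0 i) => [j|] ->.
  by rewrite rV_cons_lift mxE.
by rewrite rV_cons0.
Qed.

Lemma measurable_rV_cons n : measurable_fun setT (@rV_cons n).
Proof.
apply: measurable_fun_rVP => i; case: (unliftP ord0 i) => [j|] ->.
  under eq_fun do rewrite rV_cons_lift.
  exact: (measurableT_comp (measurable_rV_coord j)).
by under eq_fun do rewrite rV_cons0; exact: measurable_fst.
Qed.

Lemma measurable_rV_uncons n : measurable_fun setT (@rV_uncons n).
Proof.
apply: measurable_fun_pair; first exact: measurable_rV_coord.
apply: measurable_fun_rVP => i; under eq_fun do rewrite mxE.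
exact: measurable_rV_coord.
Qed.

End measurable_rV_theory.

Section lebesgue_rV_succ.
Context {R : realType} (n : nat).
Variable m : {sigma_finite_measure set 'rV[R]_n -> \bar R}.

(* The product of the Lebesgue measure on R and of m, carried over from
   R * 'rV_n to 'rV_n.+1. *)
Definition lebesgue_rV_succ : set 'rV[R]_n.+1 -> \bar R :=
  pushforward (@lebesgue_measure R \x m)%E (@rV_cons R n).

Let lebesgue_rV_succ0 : lebesgue_rV_succ set0 = 0%E.
Proof. by rewrite /lebesgue_rV_succ /pushforward preimage_set0 measure0. Qed.

Let lebesgue_rV_succ_ge0 A : (0 <= lebesgue_rV_succ A)%E.
Proof. exact: (measure_ge0 (lebesgue_measure \x m)%E). Qed.

Let lebesgue_rV_succ_sigma_additive : semi_sigma_additive lebesgue_rV_succ.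
Proof.
move=> F mF tF mUF; rewrite /lebesgue_rV_succ /pushforward preimage_bigcup.
have mcons A : measurable A -> measurable (@rV_cons R n @^-1` A).
  by move=> mA; rewrite -[X in measurable X]setTI; exact: measurable_rV_cons.
apply: (@measure_semi_sigma_additive _ _ _ (lebesgue_measure \x m)%E).
- by move=> i; exact: mcons.
- apply/trivIsetP => /= i j _ _ ij; rewrite -preimage_setI.
  by move/trivIsetP : tF => /(_ _ _ _ _ ij) ->//; rewrite preimage_set0.
- by rewrite -preimage_bigcup; exact: mcons.
Qed.

HB.instance Definition _ := isMeasure.Build _ _ _ lebesgue_rV_succ
  lebesgue_rV_succ0 lebesgue_rV_succ_ge0 lebesgue_rV_succ_sigma_additive.

Let lebesgue_rV_succ_sigma_finite : sigma_finite setT lebesgue_rV_succ.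
Proof.
have /sigma_finiteP[F [TF ndF Foo]] := sigma_finiteT (@lebesgue_measure R).
have /sigma_finiteP[G [TG ndG Goo]] := sigma_finiteT m.
have mX i : measurable (F i `*` G i).
  by have [? _] := Foo i; have [? _] := Goo i; exact: measurableX.
exists (fun i => @rV_uncons R n @^-1` (F i `*` G i)).
  rewrite -preimage_bigcup (_ : \bigcup_i _ = setT) ?preimage_setT//.
  rewrite -subTset -setXTT TF TG => -[x y] /= [[i _ Fix] [j _ Gjy]].
  exists (maxn i j) => //; split.
  - by move: x Fix; exact/subsetPset/ndF/leq_maxl.
  - by move: y Gjy; exact/subsetPset/ndG/leq_maxr.
move=> i; split.
  by have := @measurable_rV_uncons R n measurableT _ (mX i); rewrite setTI.
rewrite /lebesgue_rV_succ /pushforward -comp_preimage.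
rewrite (_ : @rV_uncons R n \o @rV_cons R n = id); last first.
  by apply/funext => x; exact: rV_consK.
have [mF Fioo] := Foo i; have [mG Gioo] := Goo i.
rewrite preimage_id product_measure1E//; apply: lte_mul_pinfty => //.
by rewrite ge0_fin_numE.
Qed.

HB.instance Definition _ := Measure_isSigmaFinite.Build _ _ _ lebesgue_rV_succ
  lebesgue_rV_succ_sigma_finite.

End lebesgue_rV_succ.

Fixpoint lebesgue_rV {R : realType} n :
    {sigma_finite_measure set 'rV[R]_n -> \bar R} :=
  match n with
  | 0 => \d_(0 : 'rV[R]_0)
  | n'.+1 => lebesgue_rV_succ (lebesgue_rV n')
  end.

(* Characterization of the Lebesgue measure of R^n by the volume of boxes. *)
Lemma lebesgue_rV_box {R : realType} n (A : 'I_n -> set R) :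
  (forall i, measurable (A i)) ->
  (lebesgue_rV n [set v : 'rV[R]_n | forall i, A i (v ord0 i)] =
   \prod_(i < n) lebesgue_measure (A i))%E.
Proof.
elim: n A => [|n IH] A mA.
  by rewrite big_ord0/= diracE mem_set//= => -[].
rewrite big_ord_recl -IH// /= /lebesgue_rV_succ /pushforward.
rewrite (_ : _ @^-1` _ = A ord0 `*`
  [set v : 'rV[R]_n | forall i, A (lift ord0 i) (v ord0 i)]); last first.
  apply/seteqP; split => -[a v] /=.
    move=> h; split; first by have := h ord0; rewrite rV_cons0.
    by move=> i; have := h (lift ord0 i); rewrite rV_cons_lift.
  move=> [h0 h] i; case: (unliftP ord0 i) => [j|] ->.
    by rewrite rV_cons_lift; exact: h.
  by rewrite rV_cons0.
rewrite product_measure1E//; first exact: mA.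
rewrite (_ : [set v | _] = \bigcap_i
  [set v : 'rV[R]_n | A (lift ord0 i) (v ord0 i)]); last first.
  by apply/seteqP; split => v /= h i; [move=> _|]; apply: h.
apply: fin_bigcap_measurable => // i _.
rewrite -[X in measurable X]setTI.
exact: measurable_rV_coord.
Qed.

Section function_spaces.
Context {R : realType} (N : nat).
Local Notation RN := 'rV[R]_N.
Local Notation mu := (@lebesgue_rV R N).
Implicit Types (u f r p V : RN -> R).

Definition inf_RN f : \bar R := ereal_inf [set (f x)%:E | x in [set: RN]].

Definition ll (a b : RN -> R) : Prop := (0 < inf_RN (b \- a)%R)%E.

(* The relation a << b when a or b is only an element of L^oo. *)
Definition ess_ll (a b : RN -> R) : Prop :=
  (0 < ess_inf mu (EFin \o (b \- a)%R))%E.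

Definition modular r u : \bar R := (\int[mu]_x (`|u x| `^ r x)%:E)%E.

(* The Luxemburg norms take values in \bar R: the infimum of the empty set
   is +oo. *)
Definition luxemburg r u : \bar R :=
  ereal_inf [set xi%:E | xi in [set xi : R |
    0 < xi /\ (modular r (fun x => u x / xi)%R <= 1)%E]].

Definition Lvar r : set (RN -> R) :=
  [set u | measurable_fun setT u /\ (modular r u < +oo)%E].

Definition evec (i : 'I_N) : RN := delta_mx ord0 i.

Definition grad u (x : RN) : RN := \row_i 'D_(evec i) u x.

(* The canonical norm of 'rV[R]_N is the maximum norm. *)
Definition enorm (v : RN) : R := Num.sqrt (\sum_i v ord0 i ^+ 2).

Fixpoint is_Ck (k : nat) f : Prop :=
  match k with
  | 0 => continuous f
  | k'.+1 => continuous f /\ forall i, (forall x, derivable f x (evec i)) /\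
               is_Ck k' (fun x => 'D_(evec i) f x)
  end.

Definition Cc_infty : set (RN -> R) :=
  [set f | (forall k, is_Ck k f) /\ compact (closure [set x | f x != 0])].

Definition normX p V u : \bar R :=
  ereal_inf [set xi%:E | xi in [set xi : R | 0 < xi /\
    (\int[mu]_x (enorm (xi^-1 *: grad u x) `^ p x
                 + V x * `|u x / xi| `^ p x)%:E <= 1)%E]].

Section completion.
Context (X : completeNormedModType R).
Implicit Types (iota : (RN -> R) -> X) (J : X -> RN -> R).

(* X, together with iota, is the completion of Cc_infty for normX p V: a Banach
   space in which Cc_infty is embedded linearly and isometrically, with dense
   image. The values of iota outside Cc_infty are irrelevant. *)
Definition is_completion p V iota : Prop :=
  [/\ forall (a : R) f g, f \in Cc_infty -> g \in Cc_infty ->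
        iota (fun x => a * f x + g x) = a *: iota f + iota g,
      forall f, f \in Cc_infty -> `|iota f|%:E = normX p V f &
      dense (iota @` Cc_infty)].

(* The element z of X is identified with the function u: some sequence of
   test functions converges to z in X and to u in L^p(x). Such a sequence is
   Cauchy in W^1,p(x), so that u is the function in W^1,p(x) which is the image
   of z under the continuous extension of the identity of Cc_infty. *)
Definition identified p iota (z : X) u : Prop :=
  u \in Lvar p /\
  exists phi : nat -> RN -> R,
    [/\ forall n, phi n \in Cc_infty,
        iota (phi n) @[n --> \oo] --> z &
        luxemburg p (phi n \- u) @[n --> \oo] --> 0%E].

Definition continuous_embedding r J : Prop :=
  [/\ forall z, J z \in Lvar r,
      forall (a : R) y z, {ae mu, forall x, J (a *: y + z) x = a * J y x + J z x},
      forall y z, {ae mu, forall x, J y x = J z x} -> y = z &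
      forall z, luxemburg r (J y \- J z) @[y --> z] --> 0%E].

(* Bounded sequences are mapped to sequences having a subsequence that
   converges in L^r(x). *)
Definition compact_map r J : Prop :=
  forall z : nat -> X, (exists M : R, forall n, `|z n| <= M) ->
  exists s : nat -> nat, {homo s : m n / (m < n)%N} /\
  exists2 v, v \in Lvar r &
    luxemburg r (J (z (s n)) \- v) @[n --> \oo] --> 0%E.

End completion.
End function_spaces.

(* Main.v *)
(* A bounded sequence of test functions is bounded in W^{1,1} on every bounded
   set, uniformly under translations, because |t| <= 1 + |t|^p(x). Hence its
   averages over the cells of a fine mesh approximate it in L^1 there; along an
   ultrafilter all these averages converge, and so a subsequence converges almost
   everywhere.
   Convergence in L^q(x) is controlled by the pointwise bound
     |w|^q <= eps V |w|^p + C_eps V^{-q/(p-q)},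
   whose last term is integrable: with eps = 1 it gives the continuity of the
   embedding, and with eps -> 0 and dominated convergence it turns almost
   everywhere convergence into convergence in L^q(x), without localization.
   The map from X to functions is injective because the gradient is closable: if
   phi_n -> 0 a.e. and d_i phi_n -> g in L^p(x), then by the fundamental theorem of
   calculus on almost every line parallel to e_i the primitive of g vanishes, so
   that g = 0, and Fatou's lemma gives phi_n -> 0 in X. *)

Require Import Defs.
From HB Require Import structures.
From mathcomp Require Import all_boot all_order all_algebra.
From mathcomp Require Import all_classical all_reals all_analysis.
From mathcomp Require Import measurable_realfun ess_sup_inf.
From mathcomp Require Import ring lra zify.

Set Implicit Arguments.
Unset Strict Implicit.
Unset Printing Implicit Defensive.

Import Order.TTheory GRing.Theory Num.Theory.
Import numFieldNormedType.Exports.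

Local Open Scope classical_set_scope.
Local Open Scope ring_scope.

(** * Lebesgue measure on R^n *)

(** Luxemburg norms are infima in [\bar R], awkward to add or to scale. The estimates are therefore
    stated with [gauge], which compares a modular with 1 at a given scale. Convexity of t^r for r >=
    1 gives the triangle inequality, c^(-r) <= c^(-1) for c >= 1 lets constants be absorbed into the
    scale, and Fatou's lemma preserves a gauge bound under almost everywhere convergence. The
    function attached to an element of the completion is not tied to a chosen sequence: [represents]
    compares it with all test functions at once, so that linearity and uniqueness become three-term
    estimates. The exponent q satisfies its bounds only almost everywhere; a truncation q' satisfies
    them everywhere and equals q almost everywhere. The lower bound of p passes to every point by
    continuity. A line parallel to e_i is the map s -> x + s e_i with x ranging over the whole
    space. Tonelli's theorem on R^N x R and translation invariance then replace any splitting of R^N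
    into the i-th coordinate and the others. *)

Section translation_R.
Context {R : realType}.
Local Notation lambda := (@lebesgue_measure R).

Let measurable_shift (a : R) :
  measurable_fun [set: measurableTypeR R]
    (fun x : measurableTypeR R => x + a : measurableTypeR R).
Proof. exact: measurable_funD. Qed.

Let shift_mfun (a : R) : {mfun measurableTypeR R >-> measurableTypeR R} :=
  HB.pack (fun x : measurableTypeR R => x + a)
    (isMeasurableFun.Build _ _ _ _ _ (measurable_shift a)).

(** The image of the measure under the shift has the same values on half-open intervals, and these
    determine Lebesgue measure. *)
Lemma lebesgue_measure_shift (a : R) (A : set (measurableTypeR R)) :
  measurable A -> lambda ((fun x => x + a) @^-1` A) = lambda A.
Proof.
move=> mA; apply/esym.
apply: (@lebesgue_measure_unique _ (pushforward lambda (shift_mfun a))) => //.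
move=> _ [[u v] /= _ <-].
rewrite /pushforward (_ : _ @^-1` _ = `]u - a, v - a]%classic); last first.
  by apply/seteqP; split => x /=; rewrite !in_itv/= ltrBlDr lerBrDr.
by rewrite !lebesgue_measure_itv/= !lte_fin ltrD2r; case: ifPn => // _;
  rewrite -!EFinB opprB addrA subrK.
Qed.

Lemma ge0_integral_shift (a : R) (f : R -> \bar R) :
  measurable_fun [set: measurableTypeR R] f -> (forall x, 0 <= f x)%E ->
  (\int[lambda]_x f (x + a)%R = \int[lambda]_x f x)%E.
Proof.
move=> mf f0; apply/esym.
transitivity (\int[pushforward lambda (shift_mfun a)]_x f x)%E.
  apply: eq_measure_integral => A mA _.
  exact: (esym (lebesgue_measure_shift a mA)).
by rewrite ge0_integral_pushforward.
Qed.

End translation_R.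

Section translation_rV.
Context {R : realType}.

Lemma measurable_rV_shift n (v : 'rV[R]_n) :
  measurable_fun [set: 'rV[R]_n] (fun x => x + v).
Proof.
apply: measurable_fun_rVP => i; under eq_fun do rewrite mxE.
by apply: measurable_funD => //; exact: measurable_rV_coord.
Qed.

(** By induction on the dimension: the measure of [A] is the integral of the measures of its
    sections. The induction hypothesis removes the shift inside each section, and the
    one-dimensional case removes the shift of the sectioning variable. *)
Lemma lebesgue_rV_shift n (v : 'rV[R]_n) (A : set 'rV[R]_n) :
  measurable A -> lebesgue_rV n ((fun x => x + v) @^-1` A) = lebesgue_rV n A.
Proof.
elim: n v A => [|n IH] v A mA.
  rewrite (_ : (fun x => x + v) = id) ?preimage_id//.
  by apply/funext => x; apply/rowP => -[].
pose v' : 'rV[R]_n := \row_i v ord0 (lift ord0 i).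
have consD s y : rV_cons (s, y) + v = rV_cons (s + v ord0 ord0, y + v').
  apply/rowP => i; case: (unliftP ord0 i) => [j|] ->.
    by rewrite mxE !rV_cons_lift !mxE.
  by rewrite mxE !rV_cons0.
rewrite /= /lebesgue_rV_succ /pushforward.
set B := @rV_cons R n @^-1` A.
have mB : measurable B.
  by rewrite -[X in measurable X]setTI; exact: measurable_rV_cons.
rewrite /product_measure1.
under eq_integral => s _.
  rewrite /= (_ : xsection _ s =
      (fun x => x + v') @^-1` (xsection B (s + v ord0 ord0))); last first.
    by apply/seteqP; split => y /xsectionP h; apply/xsectionP;
      move: h; rewrite /B /= consD.
  rewrite IH; last exact: measurable_xsection.
  over.
rewrite (ge0_integral_shift (v ord0 ord0) (f := fun s => lebesgue_rV n (xsection B s)))//.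
exact: measurable_fun_xsection.
Qed.

Let shift_mfun n (v : 'rV[R]_n) : {mfun 'rV[R]_n >-> 'rV[R]_n} :=
  HB.pack (fun x : 'rV[R]_n => x + v)
    (isMeasurableFun.Build _ _ _ _ _ (measurable_rV_shift v)).

Lemma ge0_integral_rV_shift n (v : 'rV[R]_n) (f : 'rV[R]_n -> \bar R) :
  measurable_fun setT f -> (forall x, 0 <= f x)%E ->
  (\int[lebesgue_rV n]_x f (x + v)%R = \int[lebesgue_rV n]_x f x)%E.
Proof.
move=> mf f0; apply/esym.
transitivity (\int[pushforward (lebesgue_rV n) (shift_mfun v)]_x f x)%E.
  apply: eq_measure_integral => A mA _.
  exact: (esym (lebesgue_rV_shift v mA)).
by rewrite ge0_integral_pushforward.
Qed.

End translation_rV.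

(** * Meshes of half-open cubes, and measurability of open sets *)

Section cells.
Context {R : realType} (n : nat).
Implicit Types (k : nat) (j : {ffun 'I_n -> int}).

(** The mesh of half-open cubes of side 1/(k+1). With floors, the cells partition the space and the
    cell of a point is computed by [cell_index]. *)
Definition cell k j : set 'rV[R]_n :=
  [set v | forall i, Num.floor (v ord0 i * k.+1%:R) = j i].

Definition cell_index k (v : 'rV[R]_n) : {ffun 'I_n -> int} :=
  [ffun i => Num.floor (v ord0 i * k.+1%:R)].

Lemma cellP k j v : cell k j v <-> cell_index k v = j.
Proof.
split=> [h|<- i]; first by apply/ffunP => i; rewrite ffunE h.
by rewrite ffunE.
Qed.

Let cell_side k (m : int) :
  [set r : R | Num.floor (r * k.+1%:R) = m] =
  `[m%:~R / k.+1%:R, (m + 1)%:~R / k.+1%:R[%classic.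
Proof.
apply/seteqP; split => r /=; rewrite in_itv/=.
  move/eqP; rewrite floor_eq => /andP[h1 h2].
  by rewrite ler_pdivrMr// h1 ltr_pdivlMr.
rewrite ler_pdivrMr// ltr_pdivlMr// => /andP[h1 h2].
by apply/eqP; rewrite floor_eq h1 h2.
Qed.

Lemma cell_diam k j (v w : 'rV[R]_n) i : cell k j v -> cell k j w ->
  `|v ord0 i - w ord0 i| < k.+1%:R^-1.
Proof.
move=> /(_ i) hv /(_ i) hw.
have : [set r : R | Num.floor (r * k.+1%:R) = j i] (v ord0 i) by [].
have : [set r : R | Num.floor (r * k.+1%:R) = j i] (w ord0 i) by [].
rewrite cell_side /= !in_itv/= intrD mulrDl mul1r => /andP[w1 w2] /andP[v1 v2].
move: w1 w2 v1 v2; rewrite ltr_norml.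
move: (k.+1%:R^-1) (_ / _) => e c w1 w2 v1 v2.
by apply/andP; split; lra.
Qed.

Lemma measurable_cell k j : measurable (cell k j).
Proof.
rewrite (_ : cell k j = \bigcap_(i in [set: 'I_n])
  ((fun v : 'rV[R]_n => v ord0 i) @^-1` [set r : R | Num.floor (r * k.+1%:R) = j i])).
  apply: fin_bigcap_measurable => // i _.
  rewrite -[X in measurable X]setTI; apply: measurable_rV_coord => //.
  by rewrite cell_side; exact: measurable_itv.
by apply/seteqP; split => [v h i _|v h i]; apply: h.
Qed.

Lemma lebesgue_rV_cell k j :
  lebesgue_rV n (cell k j) = ((k.+1%:R^-1) ^+ n)%:E :> \bar R.
Proof.
rewrite (@lebesgue_rV_box _ _ (fun i => [set r : R | Num.floor (r * k.+1%:R) = j i])).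
  under eq_bigr => i _.
    rewrite cell_side lebesgue_measure_itv/= lte_fin.
    rewrite ltr_pM2r ?invr_gt0// ltr_int ltzD1 lexx -EFinB -mulrBl intrD.
    rewrite [_ + 1%:~R]addrC addrK mul1r.
    over.
  by rewrite -(big_morph _ EFinM erefl) prodr_const card_ord.
by move=> i; rewrite cell_side; exact: measurable_itv.
Qed.

(** The canonical norm is the maximum norm, so a cell of side less than [e] lies in the ball of
    radius [e] around each of its points. The union is countable, which places open sets in the
    sigma-algebra generated by the coordinates. *)
Lemma open_bigcup_cell (U : set 'rV[R]_n) : open U ->
  U = \bigcup_(kj in [set kj | cell kj.1 kj.2 `<=` U]) cell kj.1 kj.2.
Proof.
move=> oU; apply/seteqP; split; last by move=> v [[k j] /= + ?]; exact.
move=> v Uv; have /nbhs_ballP[e /= e0 eU] : nbhs v U by exact: open_nbhs_nbhs.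
have [k ke] : exists k, k.+1%:R^-1 < e.
  have [k _ /(_ _ (leqnn k))] := near_infty_natSinv_lt (PosNum e0).
  by exists k.
exists (k, cell_index k v) => /=; last exact/cellP.
move=> w vw; apply: eU; split=> // i l.
have vv : cell k (cell_index k v) v by exact/cellP.
rewrite (ord1 i) /ball/=; apply: lt_trans ke; exact: cell_diam vv vw.
Qed.

Lemma open_measurable_rV (U : set 'rV[R]_n) : open U -> measurable U.
Proof.
move=> /open_bigcup_cell ->; rewrite bigcup_mkcond.
apply: countable_bigcupT_measurable => [|kj]; first exact: countableP.
by case: ifPn => // _; exact: measurable_cell.
Qed.

Lemma continuous_measurable_rV (f : 'rV[R]_n -> R) :
  continuous f -> measurable_fun setT f.
Proof.
move=> /continuousP cf; apply: (measurability _ (RGenOpens.measurableE R)).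
move=> _ [_ [a [b ->] <-]]; rewrite setTI.
by apply: open_measurable_rV; apply: cf; exact: interval_open.
Qed.

Lemma lebesgue_rV_open_gt0 (U : set 'rV[R]_n) : open U -> U !=set0 ->
  (0 < lebesgue_rV n U)%E.
Proof.
move=> oU [v Uv]; have := Uv; rewrite {1}(open_bigcup_cell oU) => -[[k j] /= jU _].
apply: (@lt_le_trans _ _ (lebesgue_rV n (cell k j))).
  by rewrite lebesgue_rV_cell lte_fin exprn_gt0// invr_gt0.
by apply: le_measure => //; rewrite inE;
  [exact: measurable_cell|exact: open_measurable_rV].
Qed.

End cells.

(** * Modulars with variable exponent *)

Section powR_extra.
Context {R : realType}.
Implicit Types a b r s t : R.

Lemma measurable_powR2 d (T : measurableType d) (f r : T -> R) :
  measurable_fun setT f -> measurable_fun setT r ->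
  measurable_fun setT (fun x => f x `^ r x).
Proof.
move=> mf mr; rewrite /powR; apply: measurable_fun_ifT.
- exact: measurable_fun_eqr.
- apply: (@measurableT_comp _ _ _ _ _ _ (fun b : bool => b%:R : R)) => //.
  exact: measurable_fun_eqr.
- apply: measurableT_comp => //; apply: measurable_funM => //.
  exact: measurableT_comp.
Qed.

Lemma powR_cvg (u : nat -> R) l r : 1 <= r -> (forall n, 0 <= u n) ->
  u @ \oo --> l -> u n `^ r @[n --> \oo] --> l `^ r.
Proof.
move=> r1 u0 ul.
have l0 : 0 <= l.
  rewrite -(cvg_lim _ ul)//.
  by apply: limr_ge; [apply/cvg_ex; exists l|exact: nearW].
move: l0; rewrite le_eqVlt => /predU1P[l0|l0]; last first.
  have cl : {for l, continuous (fun x => x `^ r)}.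
    by apply: differentiable_continuous; apply/derivable1_diffP;
      apply: derivable_powR; rewrite in_itv/= l0.
  exact: (continuous_cvg _ cl ul).
(* At the limit 0 the power function need not be differentiable from both sides; there u^r <= u as
   soon as u < 1, and squeezing suffices. *)
rewrite -l0 powR0; last by rewrite gt_eqF// (lt_le_trans _ r1).
apply: (@squeeze_cvgr _ _ _ _ (fun=> 0) u) => //; [|exact: cvg_cst|by rewrite l0].
have : \forall n \near \oo, u n < 1.
  by move: ul; rewrite -l0 => /cvgr_lt; apply.
apply: filterS => n un1; rewrite powR_ge0/=.
have := u0 n; rewrite le_eqVlt => /predU1P[<-|un0].
  by rewrite powR0// gt_eqF// (lt_le_trans _ r1).
by apply: ge1r_powR => //; rewrite un0 ltW.
Qed.

Lemma powR_convex (t a b r : R) : 0 <= t <= 1 -> 0 <= a -> 0 <= b -> 1 <= r ->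
  (t * a + (1 - t) * b) `^ r <= t * a `^ r + (1 - t) * b `^ r.
Proof.
move=> /andP[t0 t1] a0 b0 r1.
have := @convex_powR R r r1 (Itv01 t0 t1) a b.
by rewrite !inE/= !in_itv/= !andbT => /(_ a0 b0); rewrite !convRE.
Qed.

End powR_extra.

Section fatou_ae.
Local Open Scope ereal_scope.
Context d (T : measurableType d) (R : realType).
Variable mu : {measure set T -> \bar R}.

(** The form in which bounds pass to limits below: convergence off a null set, and a bound [M] on
    the integrals of large index only. *)
Lemma fatou_ae (f : nat -> T -> \bar R) (g : T -> \bar R) (M : \bar R) :
  (forall n, measurable_fun setT (f n)) -> (forall n x, 0 <= f n x) ->
  measurable_fun setT g -> (forall x, 0 <= g x) ->
  {ae mu, forall x, f n x @[n --> \oo] --> g x} ->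
  (\forall n \near \oo, \int[mu]_x f n x <= M) ->
  \int[mu]_x g x <= M.
Proof.
move=> mf f0 mg g0 [A [mA A0 fgA]] fM.
have mAC : measurable (~` A) by exact: measurableC.
rewrite (ge0_negligible_integral _ _ _ _ A0)// setTD.
rewrite (eq_integral (fun x => limn_einf (f ^~ x))); last first.
  move=> x; rewrite inE => /= Ax; apply/esym/(cvg_limn_einf_sup _).1.
  by apply: contrapT => h; apply: Ax; exact: fgA.
apply: (le_trans (fatou _ _ _ _)) => //.
  by move=> n; exact: measurable_funTS.
rewrite limn_einf_lim; apply: lime_le; first exact: is_cvg_einfs.
apply: filterS fM => n; apply: le_trans.
apply: (@le_trans _ _ (\int[mu]_(x in ~` A) f n x)).
  by apply: ereal_inf_lbound; exists n => /=.
by apply: ge0_subset_integral.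
Qed.

End fatou_ae.

Section weighted_modular.
Context d (T : measurableType d) (R : realType).
Variable mu : {measure set T -> \bar R}.
Implicit Types (W r u v : T -> R) (xi eta : R).

Definition wmod W r u : \bar R := (\int[mu]_x (W x * `|u x| `^ r x)%R%:E)%E.

(* [gauge W r u xi] says that the Luxemburg norm of [u] for the modular
   [wmod W r] is at most [xi]. *)
Definition gauge W r u xi : Prop := (wmod W r (fun x => u x / xi)%R <= 1)%E.

Variables (W r : T -> R).
Hypotheses (mW : measurable_fun setT W) (mr : measurable_fun setT r).
Hypotheses (W0 : forall x, 0 <= W x) (r1 : forall x, 1 <= r x).

Let r0 x : 0 <= r x. Proof. exact: le_trans (r1 x). Qed.

Lemma measurable_wmod u : measurable_fun setT u ->
  measurable_fun setT (fun x => (W x * `|u x| `^ r x)%R%:E).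
Proof.
move=> mu'; apply/measurable_EFinP; apply: measurable_funM => //.
by apply: measurable_powR2 => //; exact: measurableT_comp.
Qed.

Let measurable_div u xi : measurable_fun setT u ->
  measurable_fun setT (fun x => u x / xi).
Proof. by move=> mu'; exact: measurable_funM. Qed.

Lemma wmod_integrand_ge0 u x : (0 <= (W x * `|u x| `^ r x)%R%:E)%E.
Proof. by rewrite lee_fin mulr_ge0// powR_ge0. Qed.

Lemma le_wmod u v : measurable_fun setT u -> measurable_fun setT v ->
  {ae mu, forall x, `|u x| <= `|v x|} -> (wmod W r u <= wmod W r v)%E.
Proof.
move=> mu' mv uv; apply: ae_ge0_le_integral => //.
- by move=> x _; exact: wmod_integrand_ge0.
- exact: measurable_wmod.
- by move=> x _; exact: wmod_integrand_ge0.
- exact: measurable_wmod.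
apply: filterS uv => x uvx _; rewrite lee_fin ler_wpM2l//.
by apply: ge0_ler_powR; rewrite ?nnegrE.
Qed.

Lemma le_gauge u v xi eta : measurable_fun setT u -> measurable_fun setT v ->
  0 < xi -> xi <= eta -> {ae mu, forall x, `|u x| <= `|v x|} ->
  gauge W r v xi -> gauge W r u eta.
Proof.
move=> mu' mv xi0 xieta uv; apply: le_trans.
apply: le_wmod; [exact: measurable_div|exact: measurable_div|].
apply: filterS uv => x uvx; rewrite !normrM ler_pM// !normfV.
by rewrite lef_pV2 ?posrE ?normr_gt0 ?gt_eqF// ?(lt_le_trans xi0)//
  !gtr0_norm// (lt_le_trans xi0).
Qed.

(** The triangle inequality of the Luxemburg norm: (u + v) / (xi + eta) is the convex combination of
    u / xi and v / eta with weight t = xi / (xi + eta), and the integrand is convex because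
    [r >= 1]. *)
Lemma gaugeD u v xi eta : measurable_fun setT u -> measurable_fun setT v ->
  0 < xi -> 0 < eta -> gauge W r u xi -> gauge W r v eta ->
  gauge W r (fun x => u x + v x) (xi + eta).
Proof.
move=> mu' mv xi0 eta0 gu gv.
have s0 : 0 < xi + eta by rewrite addr_gt0.
pose t := xi / (xi + eta).
have t01 : 0 <= t <= 1.
  by rewrite /t divr_ge0 ?(ltW xi0) ?(ltW s0)//= ler_pdivrMr// mul1r lerDl ltW.
have [t0 t1] := andP t01.
have t0' : 0 <= 1 - t by rewrite subr_ge0.
rewrite /gauge; apply: (@le_trans _ _ (\int[mu]_x
   (t%:E * (W x * `|u x / xi| `^ r x)%R%:E +
    (1 - t)%:E * (W x * `|v x / eta| `^ r x)%R%:E))%E).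
  apply: ge0_le_integral => //.
  - by move=> x _; rewrite lee_fin mulr_ge0// powR_ge0.
  - by apply: measurable_wmod; apply: measurable_div; exact: measurable_funD.
  - by apply: emeasurable_funD; apply: measurable_funeM; apply: measurable_wmod;
      exact: measurable_div.
  move=> x _ /=; rewrite -!EFinM -EFinD lee_fin.
  rewrite (_ : (t * _ + _)%R = W x * (t * `|u x / xi| `^ r x +
    (1 - t) * `|v x / eta| `^ r x)); last by ring.
  rewrite ler_wpM2l//.
  apply: le_trans (powR_convex t01 _ _ _) => //.
  have -> : (u x + v x) / (xi + eta) = t * (u x / xi) + (1 - t) * (v x / eta).
    by rewrite /t; field; rewrite !gt_eqF.
  apply: ge0_ler_powR => //.
  - by rewrite nnegrE; apply: addr_ge0; apply: mulr_ge0.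
  - by rewrite (le_trans (ler_normD _ _))// [`|t * _|]normrM (ger0_norm t0)
      [`|(1 - t) * _|]normrM (ger0_norm t0').
rewrite ge0_integralD//; last 4 first.
- by move=> x _; apply: mule_ge0; rewrite ?lee_fin// mulr_ge0// powR_ge0.
- by apply: measurable_funeM; apply: measurable_wmod; exact: measurable_div.
- by move=> x _; apply: mule_ge0; rewrite ?lee_fin// mulr_ge0// powR_ge0.
- by apply: measurable_funeM; apply: measurable_wmod; exact: measurable_div.
rewrite !ge0_integralZl_EFin//; last 4 first.
- by move=> x _; rewrite lee_fin mulr_ge0// powR_ge0.
- by apply: measurable_wmod; exact: measurable_div.
- by move=> x _; rewrite lee_fin mulr_ge0// powR_ge0.
- by apply: measurable_wmod; exact: measurable_div.
rewrite (_ : 1%E = t%:E * 1 + (1 - t)%:E * 1)%E.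
  by apply: leeD; apply: lee_wpmul2l;
    [rewrite lee_fin|exact: gu|rewrite lee_fin|exact: gv].
by rewrite !mule1 -EFinD addrC subrK.
Qed.

Lemma gaugeM (a : R) u xi : measurable_fun setT u -> 0 < xi -> gauge W r u xi ->
  forall eta, `|a| * xi <= eta -> 0 < eta -> gauge W r (fun x => a * u x) eta.
Proof.
move=> mu' xi0 gu eta aeta eta0; apply: le_trans gu.
apply: le_wmod; [by apply: measurable_div; exact: measurable_funM|
                 exact: measurable_div|].
apply: aeW => x; rewrite !normrM !normfV (gtr0_norm eta0) (gtr0_norm xi0).
rewrite [X in X <= _]mulrAC [X in X <= _]mulrC ler_wpM2l//.
by rewrite ler_pdivrMr// mulrC ler_pdivlMr.
Qed.

Lemma wmod_cvg (u : nat -> T -> R) v : (forall n, measurable_fun setT (u n)) ->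
  measurable_fun setT v ->
  {ae mu, forall x, u n x @[n --> \oo] --> v x} ->
  forall M, (\forall n \near \oo, (wmod W r (u n) <= M)%E) -> (wmod W r v <= M)%E.
Proof.
move=> mun mv uv M uM.
apply: (@fatou_ae _ _ _ mu (fun n x => (W x * `|u n x| `^ r x)%R%:E)).
- by move=> n; exact: measurable_wmod.
- by move=> n x; exact: wmod_integrand_ge0.
- exact: measurable_wmod.
- by move=> x; exact: wmod_integrand_ge0.
- apply: filterS uv => x uvx; apply: cvg_EFin; first exact: nearW.
  apply: cvgMr; apply: powR_cvg => //; exact: cvg_norm.
- exact: uM.
Qed.

(** Since [r >= 1], t^r <= t for t <= 1. Hence a modular bounded by some c >= 1 drops to at most 1
    once the function is divided by c. *)
Lemma wmodZ_le (t : R) u : measurable_fun setT u -> 0 < t <= 1 ->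
  (wmod W r (fun x => t * u x)%R <= t%:E * wmod W r u)%E.
Proof.
move=> mu' /andP[t0 t1]; rewrite /wmod -ge0_integralZl_EFin//; last 3 first.
- by move=> x _; rewrite lee_fin mulr_ge0// powR_ge0.
- exact: measurable_wmod.
- exact: ltW.
apply: ge0_le_integral => //.
- by move=> x _; rewrite lee_fin mulr_ge0// powR_ge0.
- by apply: measurable_wmod; exact: measurable_funM.
- by apply: measurable_funeM; exact: measurable_wmod.
move=> x _; rewrite -EFinM lee_fin mulrCA ler_wpM2l// normrM (gtr0_norm t0).
by apply: ge1r_powRZ => //; rewrite t0.
Qed.

(** Undoing the division by [K] costs the factor K^r(x), which depends on the point; the upper bound
    [P] of the exponent makes it uniform, and the maximum with 1 makes the power increasing in the
    exponent. *)
Lemma gauge_wmod_le u K P : measurable_fun setT u -> 0 < K ->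
  (forall x, r x <= P) -> gauge W r u K ->
  (wmod W r u <= (Num.max 1 K `^ P)%:E)%E.
Proof.
move=> mu' K0 rP gu; set m := Num.max 1 K.
have m1 : 1 <= m by rewrite le_max lexx.
have Km : K <= m by rewrite le_max lexx orbT.
have c0 : 0 <= m `^ P by exact: powR_ge0.
apply: (@le_trans _ _ ((m `^ P)%:E * wmod W r (fun x => u x / K)%R)%E); last first.
  by rewrite -[leRHS]mule1; apply: lee_wpmul2l.
rewrite /wmod -ge0_integralZl_EFin//; last 2 first.
- by move=> x _; rewrite lee_fin mulr_ge0// powR_ge0.
- by apply: measurable_wmod; exact: measurable_div.
apply: ge0_le_integral => //.
- by move=> x _; rewrite lee_fin mulr_ge0// powR_ge0.
- exact: measurable_wmod.
- by apply: measurable_funeM; apply: measurable_wmod; exact: measurable_div.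
move=> x _; rewrite -EFinM lee_fin mulrCA ler_wpM2l//.
have {1}-> : `|u x| = K * `|u x / K|.
  by rewrite normrM normfV (gtr0_norm K0) mulrC divfK ?gt_eqF.
rewrite powRM ?(ltW K0)// ler_wpM2r ?powR_ge0//.
apply: (@le_trans _ _ (m `^ r x)); last exact: ler_powR.
by apply: ge0_ler_powR; rewrite ?nnegrE ?(ltW K0)// (le_trans _ m1).
Qed.

(** Writing u = t (u / t) with t <= 1 bounds the modular of [u] by t; as t tends to 0 the modular
    vanishes, and [W] is positive. *)
Lemma gauge_ae_eq0 u : measurable_fun setT u -> (forall x, 0 < W x) ->
  (forall xi, 0 < xi -> gauge W r u xi) -> {ae mu, forall x, u x = 0}.
Proof.
move=> mu' Wgt0 gu.
have u0 : wmod W r u = 0%E.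
  apply/eqP; rewrite eq_le integral_ge0 ?andbT; last first.
    by move=> x _; rewrite lee_fin mulr_ge0// powR_ge0.
  apply/lee_addgt0Pr => e e0; rewrite add0e.
  have [k _ /(_ _ (leqnn k)) ke] := near_infty_natSinv_lt (PosNum e0).
  have k0 : 0 < k.+1%:R^-1 :> R by rewrite invr_gt0.
  rewrite (_ : u = fun x => k.+1%:R^-1 * (u x / k.+1%:R^-1)); last first.
    by apply/funext => x; rewrite mulrC divfK// gt_eqF.
  apply: le_trans (wmodZ_le _ _) _; first exact: measurable_div.
    by rewrite k0 invf_le1 ?ler1n.
  apply: (@le_trans _ _ (k.+1%:R^-1%:E * 1)%E).
    by apply: lee_wpmul2l; [rewrite lee_fin ltW|exact: gu].
  by rewrite mule1 lee_fin ltW.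
have : ae_eq mu setT (fun x => (W x * `|u x| `^ r x)%R%:E) (cst 0%E).
  apply/ae_eq_integral_abs => //; first exact: measurable_wmod.
  rewrite -[RHS]u0; apply: eq_integral => x _.
  by rewrite gee0_abs// wmod_integrand_ge0.
apply: filterS => x /(_ I) [] /eqP; rewrite mulf_eq0 gt_eqF//= powR_eq0.
by rewrite normr_eq0 => /andP[/eqP].
Qed.

End weighted_modular.

Section change_of_weight.
Context d (T : measurableType d) (R : realType).
Variable mu : {measure set T -> \bar R}.
Variables (W W' r : T -> R) (c : R).
Hypotheses (mW : measurable_fun setT W) (mW' : measurable_fun setT W').
Hypotheses (mr : measurable_fun setT r) (r1 : forall x, 1 <= r x).
Hypotheses (W'0 : forall x, 0 <= W' x) (c1 : 1 <= c).
Hypothesis W'W : forall x, W' x <= c * W x.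

Lemma gauge_weight u xi : measurable_fun setT u -> 0 < xi ->
  gauge mu W r u xi -> gauge mu W' r u (c * xi).
Proof.
move=> mu' xi0 gu; have c0 : 0 < c by rewrite (lt_le_trans _ c1).
have W0 x : 0 <= W x by rewrite -(pmulr_rge0 _ c0) (le_trans _ (W'W x)).
have mdiv : measurable_fun setT (fun x => u x / xi) by exact: measurable_funM.
rewrite /gauge (_ : (fun x => _) = (fun x => c^-1 * (u x / xi))); last first.
  by apply/funext => x; rewrite invfM mulrCA mulrA.
apply: le_trans; first (apply: wmodZ_le => //).
  by rewrite invr_gt0 c0 invf_le1.
apply: (@le_trans _ _ (c^-1%:E * (c%:E * wmod mu W r (fun x => u x / xi)%R))%E).
  apply: lee_wpmul2l; first by rewrite lee_fin invr_ge0 ltW.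
  rewrite /wmod -ge0_integralZl_EFin//; last 3 first.
  - by move=> x _; rewrite lee_fin mulr_ge0// powR_ge0.
  - exact: measurable_wmod.
  - exact: ltW.
  apply: ge0_le_integral => //.
  - by move=> x _; rewrite lee_fin mulr_ge0// powR_ge0.
  - exact: measurable_wmod.
  - by apply: measurable_funeM; exact: measurable_wmod.
  by move=> x _; rewrite -EFinM lee_fin mulrA ler_wpM2r// powR_ge0.
by rewrite muleA -EFinM mulVf ?mul1e// gt_eqF.
Qed.

End change_of_weight.

Section variable_exponents.
Context d (T : measurableType d) (R : realType).
Variable mu : {measure set T -> \bar R}.
Variables (p q V : T -> R) (delta P : R).
Hypotheses (mp : measurable_fun setT p) (mq : measurable_fun setT q).
Hypotheses (mV : measurable_fun setT V) (V0 : forall x, 0 < V x).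
Hypotheses (q1 : forall x, 1 <= q x) (delta0 : 0 < delta).
Hypotheses (qp : forall x, q x + delta <= p x) (pP : forall x, p x <= P).
Hypothesis V_int : mu.-integrable setT
  (fun x => (V x `^ (- (q x / (p x - q x))))%:E).

Let h x := V x `^ (- (q x / (p x - q x))).

Let p1 x : 1 <= p x.
Proof. by apply: le_trans (q1 x) _; apply: le_trans (qp x); rewrite lerDl ltW. Qed.

Let pq0 x : 0 < p x - q x.
Proof. by rewrite subr_gt0 (lt_le_trans _ (qp x))// ltrDl. Qed.

(* If the first term is less than [t `^ q], then [t `^ (p - q)] is less than
   [1 / (e V)], and [t `^ q] is a power of [t `^ (p - q)]. *)
Lemma powR_young (e t : R) x : 0 < e <= 1 -> 0 <= t ->
  t `^ q x <= e * V x * t `^ p x \/ t `^ q x <= e `^ (- (P / delta)) * h x.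
Proof.
move=> /andP[e0 e1] t0.
have q0 : 0 < q x by rewrite (lt_le_trans _ (q1 x)).
have [->|tN0] := eqVneq t 0.
  by right; rewrite powR0 ?gt_eqF// mulr_ge0// powR_ge0.
have tgt0 : 0 < t by rewrite lt_neqAle eq_sym tN0.
have eV0 : 0 < e * V x by rewrite mulr_gt0.
have [h1|h1] := lerP 1 (e * V x * t `^ (p x - q x)).
  left; rewrite -[p x](subrK (q x)) powRD ?tN0 ?implybT// mulrA.
  by rewrite ler_peMl// powR_ge0.
right.
have {}h1 : t `^ (p x - q x) <= (e * V x)^-1.
  by rewrite -[_^-1]mul1r ler_pdivlMr// mulrC ltW.
have s0 : 0 <= q x / (p x - q x) by rewrite divr_ge0// ltW.
have -> : t `^ q x = (t `^ (p x - q x)) `^ (q x / (p x - q x)).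
  by rewrite -powRrM mulrC divfK// gt_eqF.
apply: (@le_trans _ _ ((e * V x)^-1 `^ (q x / (p x - q x)))).
  by apply: ge0_ler_powR; rewrite ?nnegrE ?powR_ge0// invr_ge0 ltW.
rewrite -powR_inv1 ?(ltW eV0)// -powRrM mulN1r powRM ?(ltW e0) ?(ltW (V0 x))//.
rewrite ler_wpM2r ?powR_ge0//.
(* Since [e <= 1], replacing the exponent -q/(p-q) by the smaller -P/delta increases the power; this
   makes the constant independent of [x]. *)
apply: ger_powR; first by rewrite e0.
rewrite lerN2 ler_pM ?(ltW q0) ?invr_ge0 ?(ltW (pq0 x))//.
  by apply: le_trans (pP x); apply: le_trans (qp x); rewrite lerDl ltW.
by rewrite lef_pV2 ?posrE// lerBrDl.
Qed.

Let h0 x : (0 <= (h x)%:E)%E. Proof. by rewrite lee_fin powR_ge0. Qed.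

Let mh : measurable_fun setT (fun x => (h x)%:E).
Proof. exact: measurable_int V_int. Qed.

(** With [e] = 1 in [powR_young], a function of gauge 1 for [V] and [p] has q-modular at most 1 plus
    the integral of [h]. Dividing the function by this sum brings the modular below 1, so the sum
    serves as the norm of the embedding. *)
Definition embedding_const : R := 1 + fine (\int[mu]_x (h x)%:E)%E.

Let intV_fin : (\int[mu]_x (h x)%:E)%E \is a fin_num.
Proof. exact: integrable_fin_num. Qed.

Lemma embedding_const_ge1 : 1 <= embedding_const.
Proof. by rewrite lerDl fine_ge0// integral_ge0. Qed.

Lemma gauge_embedding u xi : measurable_fun setT u -> 0 < xi ->
  gauge mu V p u xi -> gauge mu (cst 1) q u (embedding_const * xi).
Proof.
move=> mu' xi0 gu; have K1 := embedding_const_ge1.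
have K0 : 0 < embedding_const by rewrite (lt_le_trans _ K1).
have mdiv : measurable_fun setT (fun x => u x / xi) by exact: measurable_funM.
rewrite /gauge (_ : (fun x => _) = (fun x => embedding_const^-1 * (u x / xi))); last first.
  by apply/funext => x; rewrite invfM mulrCA mulrA.
apply: le_trans; first (apply: wmodZ_le => //).
  by rewrite invr_gt0 K0 invf_le1.
rewrite lee_pdivrMl// mule1 EFinD fineK//.
apply: (@le_trans _ _ (\int[mu]_x
  ((V x * `|u x / xi| `^ p x)%R%:E + (h x)%:E))%E).
  apply: ge0_le_integral => //.
  - by move=> x _; rewrite lee_fin mul1r powR_ge0.
  - exact: measurable_wmod.
  - by apply: emeasurable_funD => //; exact: measurable_wmod.
  move=> x _; rewrite -EFinD lee_fin mul1r.
  have [] := @powR_young 1 `|u x / xi| x; rewrite ?ltr01 ?lexx// ?mul1r ?powR1 ?mul1r => hx.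
    by rewrite (le_trans hx)// lerDl powR_ge0.
  by rewrite (le_trans hx)// lerDr mulr_ge0 ?powR_ge0 ?ltW.
rewrite ge0_integralD//; last 2 first.
- by move=> x _; rewrite lee_fin mulr_ge0 ?powR_ge0 ?ltW.
- exact: measurable_wmod.
by rewrite leeD2r.
Qed.

(* Where [V |w n| ^ p] does not control [|w n| ^ q], the latter is dominated by
   a multiple of the integrable function [h]. *)
Lemma gauge_embedding_cvg0 (w : nat -> T -> R) (K : R) :
  (forall n, measurable_fun setT (w n)) -> 0 < K ->
  (forall n, gauge mu V p (w n) K) ->
  {ae mu, forall x, w n x @[n --> \oo] --> 0} ->
  forall xi, 0 < xi -> \forall n \near \oo, gauge mu (cst 1) q (w n) xi.
Proof.
move=> mw K0 gw w0 xi xi0.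
have mdiv n : measurable_fun setT (fun x => w n x / xi) by exact: measurable_funM.
(* The function w n / xi has gauge K / xi, so [c] bounds its modular with weight [V] uniformly in
   [n]. *)
pose m := Num.max 1 (K / xi).
have m1 : 1 <= m by rewrite le_max lexx.
pose c := m `^ P.
have P0 : 0 <= P by rewrite (le_trans _ (pP point))// (le_trans _ (p1 point)).
have c1 : 1 <= c by rewrite -(powRr0 m) ler_powR.
have c0 : 0 < c by rewrite (lt_le_trans _ c1).
have Vc n : (wmod mu V p (fun x => w n x / xi)%R <= c%:E)%E.
  apply: gauge_wmod_le => //; [by move=> x; exact: ltW|by rewrite divr_gt0|].
  rewrite /gauge (_ : (fun x => _) = (fun x => w n x / K)); first exact: gw.
  by apply/funext => x; field; rewrite !gt_eqF.
(* The target 1 is split in halves: e c = 1/2 for the part controlled by [V], and less than 1/2 for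
   the integral of [g n] with [n] large. *)
pose e : R := (2 * c)^-1.
have e01 : 0 < e <= 1 by rewrite /e invr_gt0 mulr_gt0//= invf_le1 ?mulr_gt0//; lra.
have [e0 e1] := andP e01.
pose D := e `^ (- (P / delta)).
have D0 : 0 <= D by exact: powR_ge0.
(* The minimum keeps the second case of [powR_young]: it is dominated by the integrable [D * h] and
   tends to 0 almost everywhere with [w n]. *)
pose g n x := Num.min (`|w n x / xi| `^ q x) (D * h x).
have mwq n : measurable_fun setT (fun x => `|w n x / xi| `^ q x).
  by apply: measurable_powR2 => //; exact: measurableT_comp.
have mDh : measurable_fun setT (fun x => D * h x).
  by apply: measurable_funM => //; apply/measurable_EFinP.
have mg n : measurable_fun setT (g n) by exact: measurable_minr.
have g0 n x : 0 <= g n x by rewrite /g le_min powR_ge0 mulr_ge0// powR_ge0.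
have g_cvg : (\int[mu]_x (g n x)%:E)%E @[n --> \oo] --> 0%E.
  have [] := @dominated_convergence _ _ _ mu setT measurableT
     (fun n x => (g n x)%:E) (cst 0%E) (fun x => (D * h x)%:E).
  - by move=> n; exact/measurable_EFinP.
  - by [].
  - apply: filterS w0 => x wx _; apply: cvg_EFin; first exact: nearW.
    have q1x := q1 x.
    apply: (@squeeze_cvgr _ _ _ _ (fun=> 0) (fun n => `|w n x / xi| `^ q x)).
    + by apply: nearW => n; rewrite g0 /g ge_min lexx.
    + exact: cvg_cst.
    + rewrite -[X in _ --> X](@powR0 _ (q x)) ?gt_eqF ?(lt_le_trans _ q1x)//.
      apply: powR_cvg => //; rewrite -[X in _ --> X](normr0 R).
      by apply: cvg_norm; rewrite -[X in _ --> X](mul0r xi^-1); exact: cvgMl.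
  - apply: (eq_integrable _ (fun x => D%:E * (h x)%:E)%E) => //.
    exact: integrableZl.
  - by apply: aeW => x n _; rewrite /= lee_fin ger0_norm// /g ge_min lexx orbT.
  by move=> _ _; rewrite integral0.
have half0 : (0 < (2^-1 : R)%:E)%E by rewrite lte_fin invr_gt0.
have : \forall n \near \oo, (\int[mu]_x (g n x)%:E < (2^-1)%:E)%E.
  exact: (g_cvg _ (open_ereal_lt' half0)).
apply: filterS => n gn.
apply: (@le_trans _ _ (\int[mu]_x
  (e%:E * (V x * `|w n x / xi| `^ p x)%R%:E + (g n x)%:E))%E).
  apply: ge0_le_integral => //.
  - by move=> x _; rewrite lee_fin mul1r powR_ge0.
  - exact: measurable_wmod.
  - apply: emeasurable_funD; last exact/measurable_EFinP.
    by apply: measurable_funeM; exact: measurable_wmod.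
  move=> x _; rewrite -EFinM -EFinD lee_fin mul1r mulrA.
  have [hx|hx] := powR_young x e01 (normr_ge0 (w n x / xi)).
    by rewrite (le_trans hx)// lerDl.
  rewrite (_ : g n x = `|w n x / xi| `^ q x); last exact/min_idPl.
  by rewrite lerDr mulr_ge0 ?powR_ge0// mulr_ge0// ltW.
rewrite ge0_integralD//; last 4 first.
- by move=> x _; rewrite mule_ge0// lee_fin ?(ltW e0)// mulr_ge0 ?powR_ge0 ?ltW.
- by apply: measurable_funeM; exact: measurable_wmod.
- by move=> x _; rewrite lee_fin.
- exact/measurable_EFinP.
rewrite ge0_integralZl_EFin//; last 3 first.
- by move=> x _; rewrite lee_fin mulr_ge0 ?powR_ge0 ?ltW.
- exact: measurable_wmod.
- exact: ltW.
apply: (@le_trans _ _ (e%:E * c%:E + (2^-1)%:E)%E).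
  by apply: leeD; [apply: lee_wpmul2l; [rewrite lee_fin ltW|exact: Vc]|exact: ltW].
rewrite -EFinM -EFinD lee_fin /e invfM -mulrA mulVf ?gt_eqF//; lra.
Qed.

End variable_exponents.

(** * Almost everywhere convergence from summable increments *)

Section ae_cvg_summable.
Context d (T : measurableType d) (R : realType).
Variable mu : {measure set T -> \bar R}.

Lemma sum_half_le (C : R) n : 0 <= C -> \sum_(0 <= k < n) C / 2 ^+ k.+1 <= C.
Proof.
move=> C0; suff -> : \sum_(0 <= k < n) C / 2 ^+ k.+1 = C * (1 - (2 ^+ n)^-1).
  by rewrite ler_piMr// gerBl invr_ge0 exprn_ge0.
elim: n => [|n IH]; first by rewrite big_nil expr0 invr1 subrr mulr0.
rewrite big_nat_recr//= IH exprS; field.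
by rewrite expf_neq0.
Qed.

Lemma is_cvg_sum_dist (u : nat -> R) (M : R) :
  (forall n, \sum_(0 <= k < n) `|u k.+1 - u k| <= M) -> cvgn u.
Proof.
move=> uM.
have : cvgn (series (telescope u)).
  apply: normed_cvg; apply: nondecreasing_is_cvgn.
    by apply: nondecreasing_series => n _ _; exact: normr_ge0.
  by exists M => _ [n _ <-]; exact: uM.
move=> /cvg_ex[l ul]; apply/cvg_ex; exists (u 0%N + l).
apply: cvg_trans (cvgD (cvg_cst (u 0%N)) ul).
by apply: near_eq_cvg; apply: nearW => n /=; rewrite [RHS]eq_sum_telescope.
Qed.

(** On each [B k] the sum of the increments from some rank on has finite integral, so it is finite
    almost everywhere and the sequence converges there absolutely by telescoping. Countably many
    sets [B k] cover the space. *)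
Lemma ae_cvg_summable (u : nat -> T -> R) (B : nat -> set T) :
  (forall n, measurable_fun setT (u n)) -> (forall k, measurable (B k)) ->
  \bigcup_k B k = setT ->
  (forall k, exists2 C : R, 0 <= C & \forall m \near \oo,
    (\int[mu]_(x in B k) `|u m.+1 x - u m x|%:E <= (C / 2 ^+ m.+1)%:E)%E) ->
  exists2 v : T -> R, measurable_fun setT v &
    {ae mu, forall x, u n x @[n --> \oo] --> v x}.
Proof.
move=> mU mB UB HB.
(* The upper limit is measurable whether or not the sequence converges; [fine] makes it real, and
   only its value at points of convergence matters. *)
pose w x := limn_esup (fun n => (u n x)%:E).
exists (fine \o w).
  apply: measurableT_comp => //; apply: measurable_fun_limn_esup => n.
  exact/measurable_EFinP.
suff : {ae mu, forall x k, B k x -> cvgn (u ^~ x)}.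
  apply: filterS => x H; have [k _ Bkx] : (\bigcup_k B k) x by rewrite UB.
  have /cvg_ex[l ul] := H k Bkx.
  have : (fun n => (u n x)%:E) @ \oo --> l%:E by apply: cvg_EFin => //; exact: nearW.
  by move=> /cvg_limn_einf_sup[_]; rewrite /= /w => ->.
apply/ae_foralln => k; have [C C0 [m0 _ Hm]] := HB k.
pose f n x := `|u (n + m0).+1 x - u (n + m0)%N x|%:E.
have mf n : measurable_fun setT (f n).
  by apply/measurable_EFinP; apply: measurableT_comp => //; exact: measurable_funB.
have f0 n x : (0 <= f n x)%E by rewrite lee_fin.
have : mu.-integrable (B k) (fun x => (\sum_(0 <= n <oo) f n x)%E).
  apply/integrableP; split.
    apply: (@ge0_emeasurable_sum _ _ _ _ f xpredT) => //.
    by move=> n _; exact: measurable_funTS.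
  under eq_integral => x _ do rewrite gee0_abs ?nneseries_ge0//.
  rewrite integral_nneseries//; last by move=> n; exact: measurable_funTS.
  apply: (@le_lt_trans _ _ C%:E); last exact: ltry.
  apply: lime_le.
    by apply: is_cvg_nneseries => n _ _; exact: integral_ge0.
  apply: nearW => n; apply: (@le_trans _ _ (\sum_(0 <= i < n) (C / 2 ^+ i.+1)%:E)%E).
    apply: lee_sum => i _; apply: le_trans (Hm _ _) _; first by rewrite /= leq_addl.
    rewrite lee_fin ler_wpM2l// lef_pV2 ?posrE ?exprn_gt0//.
    by rewrite ler_eXn2l ?ltr1n// ltnS leq_addr.
  by rewrite sumEFin lee_fin sum_half_le.
move=> /(integrable_ae (mB k)); apply: filterS => x H Bx.
have := H Bx; set S := (\sum_(0 <= n <oo) f n x)%E => Sfin.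
have : cvgn (fun n => u (n + m0)%N x).
  apply: (@is_cvg_sum_dist _ (fine S)) => n.
  rewrite -lee_fin fineK// -sumEFin.
  exact: (@nneseries_lim_ge _ (fun n => f n x) xpredT).
by move=> /cvg_ex[l ul]; apply/cvg_ex; exists l; rewrite -(cvg_shiftn m0).
Qed.

End ae_cvg_summable.

(** * Translations of C^1 functions *)

Section tonelli_domains.
Local Open Scope ereal_scope.
Context d1 d2 (T1 : measurableType d1) (T2 : measurableType d2) (R : realType).
Variables (m1 : {sigma_finite_measure set T1 -> \bar R})
          (m2 : {sigma_finite_measure set T2 -> \bar R}).
Variables (A : set T1) (B : set T2) (f : T1 * T2 -> \bar R).
Hypotheses (mA : measurable A) (mB : measurable B).
Hypotheses (mf : measurable_fun setT f) (f0 : forall z, 0 <= f z).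

Let g := f \_ (A `*` B).

Let mg : measurable_fun setT g.
Proof.
by apply/(measurable_restrictT _ (measurableX mA mB)); exact: measurable_funTS.
Qed.

Let g0 z : 0 <= g z. Proof. exact: erestrict_ge0. Qed.

(** Tonelli's theorem for the extension of [f] by 0 outside [A] x [B]. *)
Lemma ge0_integral_in_exchange :
  \int[m1]_(x in A) \int[m2]_(y in B) f (x, y) =
  \int[m2]_(y in B) \int[m1]_(x in A) f (x, y).
Proof.
transitivity (\int[m1]_x \int[m2]_y g (x, y)).
  rewrite integral_mkcond; apply: eq_integral => x _; rewrite patchE.
  case: ifPn => xA; last first.
    by rewrite integral0_eq// => y _; rewrite /g patchE in_setX (negbTE xA).
  rewrite [LHS]integral_mkcond; apply: eq_integral => y _.
  by rewrite /g !patchE in_setX xA.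
rewrite fubini_tonelli// [RHS]integral_mkcond.
apply: eq_integral => y _; rewrite patchE.
case: ifPn => yB; last first.
  by rewrite integral0_eq// => x _; rewrite /g patchE in_setX (negbTE yB) andbF.
rewrite [RHS]integral_mkcond; apply: eq_integral => x _.
by rewrite /g !patchE in_setX yB andbT.
Qed.

Lemma measurable_integral_in :
  measurable_fun setT (fun x => \int[m2]_(y in B) f (x, y)).
Proof.
pose h := f \_ (setT `*` B).
have mh : measurable_fun setT h.
  apply/(measurable_restrictT _ (measurableX measurableT mB)).
  exact: measurable_funTS.
have h0 z : 0 <= h z by exact: erestrict_ge0.
rewrite (_ : (fun x => _) = fubini_F m2 h).
  exact: measurable_fun_fubini_tonelli_F.
apply/funext => x; rewrite /fubini_F [LHS]integral_mkcond; apply: eq_integral => y _.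
by rewrite /h !patchE in_setX in_setT.
Qed.

Lemma measurable_integral_in_swap :
  measurable_fun setT (fun y => \int[m1]_(x in A) f (x, y)).
Proof.
pose h := f \_ (A `*` setT).
have mh : measurable_fun setT h.
  apply/(measurable_restrictT _ (measurableX mA measurableT)).
  exact: measurable_funTS.
have h0 z : 0 <= h z by exact: erestrict_ge0.
rewrite (_ : (fun y => _) = fubini_G m1 h).
  exact: measurable_fun_fubini_tonelli_G.
apply/funext => y; rewrite /fubini_G [LHS]integral_mkcond.
by apply: eq_integral => x _; rewrite /h !patchE in_setX in_setT andbT.
Qed.

End tonelli_domains.

Section lines.
Context {R : realType} (N : nat).
Local Notation RN := 'rV[R]_N.
Local Notation mu := (@lebesgue_rV R N).
Local Notation e := (@evec R N).
Implicit Types (f : RN -> R) (x y z : RN) (i : 'I_N).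

(** The two difference quotients are the same function of [h], so derivability and the value of the
    derivative transfer between [f] and its restriction to a line without any differentiability of
    [f]. *)
Let line_quotient f x i (t : R) :
  (fun h : R => h^-1 *: (((fun s : R => f (x + s *: e i)) \o shift t) (h *: 1)
                        - f (x + t *: e i))) =
  (fun h : R => h^-1 *: ((f \o shift (x + t *: e i)) (h *: e i)
                        - f (x + t *: e i))).
Proof.
apply/funext => h /=; congr (_ *: (f _ - _)).
by rewrite [h *: 1]mulr1 scalerDl addrCA.
Qed.

Lemma derivable_line f x i (t : R) : derivable f (x + t *: e i) (e i) ->
  derivable (fun s : R => f (x + s *: e i)) t 1.
Proof. by rewrite /derivable line_quotient. Qed.

Lemma derive_line f x i (t : R) :
  derive1 (fun s : R => f (x + s *: e i)) t = 'D_(e i) f (x + t *: e i).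
Proof. by rewrite derive1E /derive line_quotient. Qed.

Lemma continuous_line (g : RN -> R) x i : continuous g ->
  continuous (fun s : R => g (x + s *: e i)).
Proof.
move=> cg s; apply: (@continuous_comp _ _ _ (fun s : R => x + s *: e i) g); last exact: cg.
apply: cvgD; first exact: cvg_cst.
by apply: cvgZl; exact: cvg_id.
Qed.

Lemma integral_line f x i (t : R) : is_Ck 1 f -> 0 < t ->
  (\int[lebesgue_measure]_(s in `[0%R, t]) ('D_(e i) f (x + s *: e i))%:E =
   (f (x + t *: e i) - f x)%:E)%E.
Proof.
move=> [cf /(_ i)[df cdf]] t0.
have cF : continuous (fun s : R => f (x + s *: e i)) by exact: continuous_line.
rewrite (@continuous_FTC2 _ _ (fun s : R => f (x + s *: e i)))//.
- by rewrite scale0r addr0 EFinB.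
- by apply: continuous_subspaceT; exact: (continuous_line (g := fun y => 'D_(e i) f y)).
- split.
  + by move=> s _; exact: derivable_line.
  + by apply: cvg_at_right_filter; exact: cF.
  + by apply: cvg_at_left_filter; exact: cF.
- by move=> s _; exact: derive_line.
Qed.

Lemma le_line f x i (t : R) : is_Ck 1 f -> 0 <= t ->
  (`|f (x + t *: e i) - f x|%:E <=
   \int[lebesgue_measure]_(s in `[0%R, t]) `|'D_(e i) f (x + s *: e i)|%:E)%E.
Proof.
move=> C1f; rewrite le_eqVlt => /predU1P[<-|t0].
  by rewrite scale0r addr0 subrr normr0; apply: integral_ge0.
rewrite -[X in (X <= _)%E]/(`|(f (x + t *: e i) - f x)%:E|)%E -integral_line//.
apply: le_abse_integral => //; apply/measurable_EFinP; apply: measurable_funTS.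
exact: (continuous_measurable_fun (continuous_line (C1f.2 i).2)).
Qed.

End lines.

Section translation_estimate.
Context {R : realType} (N : nat).
Local Notation RN := 'rV[R]_N.
Local Notation mu := (@lebesgue_rV R N).
Local Notation e := (@evec R N).
Implicit Types (f u r : RN -> R) (x y z : RN) (i : 'I_N).

Lemma measurable_shift2 : measurable_fun setT (fun z : RN * RN => z.1 + z.2).
Proof.
apply: measurable_fun_rVP => i; under eq_fun do rewrite mxE.
by apply: measurable_funD;
  apply: (measurableT_comp (measurable_rV_coord i)).
Qed.

Lemma is_C1_measurable f : is_Ck 1 f -> measurable_fun setT f.
Proof. by move=> [cf _]; exact: continuous_measurable_rV. Qed.

Lemma is_C1_measurable_derive f i : is_Ck 1 f ->
  measurable_fun setT (fun x => 'D_(e i) f x).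
Proof. by move=> [_ /(_ i)[_ cdf]]; exact: continuous_measurable_rV. Qed.

(* As [`|t| <= 1 + `|t| ^ r] when [1 <= r], the bound does not depend on [y]. *)
Lemma gauge_local r u (xi : R) (B : set RN) y : measurable_fun setT r ->
  (forall x, 1 <= r x) -> measurable_fun setT u -> 0 < xi -> measurable B ->
  gauge mu (cst 1) r u xi ->
  (\int[mu]_(x in B) `|u (x + y)|%:E <= xi%:E * (mu B + 1))%E.
Proof.
move=> mr r1 mu' xi0 mB gu.
have mdiv : measurable_fun setT (fun x => u x / xi) by exact: measurable_funM.
pose F x : \bar R := (1 * `|u x / xi| `^ r x)%:E.
have mF : measurable_fun setT F by exact: measurable_wmod.
have F0 x : (0 <= F x)%E by rewrite lee_fin mul1r powR_ge0.
have mshift := measurable_rV_shift y.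
have mFs : measurable_fun setT (fun x => F (x + y)) by exact: measurableT_comp mF mshift.
apply: (@le_trans _ _ (\int[mu]_(x in B) (xi%:E * (1 + F (x + y)%R)))%E).
  apply: ge0_le_integral => //.
  - apply/measurable_EFinP; apply: measurable_funTS.
    by apply: measurableT_comp => //; exact: (measurableT_comp mu' mshift).
  - by apply: measurable_funTS; apply: measurable_funeM; exact: emeasurable_funD.
  move=> x _; rewrite /F -EFinD -EFinM lee_fin mul1r.
  rewrite -ler_pdivrMl// -{1}(gtr0_norm xi0) -normfV -normrM [_ * u _]mulrC.
  have [h|h] := lerP `|u (x + y) / xi| 1.
    by rewrite (le_trans h)// lerDl powR_ge0.
  apply: (le_trans (le1r_powR (ltW h) (r1 (x + y)))); by rewrite lerDr.
rewrite ge0_integralZl_EFin//; last 3 first.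
- by move=> x _; rewrite adde_ge0.
- by apply: measurable_funTS; exact: emeasurable_funD.
- exact: ltW.
apply: lee_wpmul2l; first by rewrite lee_fin ltW.
rewrite ge0_integralD//; last exact: measurable_funTS.
have -> : (\int[mu]_(x in B) 1 = mu B)%E.
  by have := integral_cst mu mB 1%E; rewrite mul1e.
apply: leeD; first exact: lexx.
apply: (@le_trans _ _ (\int[mu]_x F (x + y)%R)%E).
  exact: ge0_subset_integral.
by rewrite (ge0_integral_rV_shift y).
Qed.

Variables (f : RN -> R) (B : set RN) (K : R).
Hypotheses (C1f : is_Ck 1 f) (mB : measurable B).
Hypothesis fK : forall i y,
  (\int[mu]_(x in B) `|'D_(e i) f (x + y)|%:E <= K%:E)%E.

Let mdiff y z : measurable_fun setT (fun x => `|f (x + y) - f (x + z)|%:E).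
Proof.
apply/measurable_EFinP; apply: measurableT_comp => //.
by apply: measurable_funB;
  exact: (measurableT_comp (is_C1_measurable C1f) (measurable_rV_shift _)).
Qed.

Let K_ge0 (i : 'I_N) : 0 <= K.
Proof.
by rewrite -lee_fin; apply: le_trans (fK i 0); exact: integral_ge0.
Qed.

(** The difference is at most the integral of the derivative along the segment. After exchanging the
    integrals, each [s] contributes the integral over [B] of a translated derivative, which [fK]
    bounds by [K]; because [fK] holds for all translations, [B] need not be enlarged. *)
Let translation_coord_ge0 i (t : R) z : 0 <= t ->
  (\int[mu]_(x in B) `|f (x + (z + t *: e i)) - f (x + z)|%:E <= (t * K)%:E)%E.
Proof.
move=> t0.
pose F (w : RN * measurableTypeR R) : \bar R :=
  `|'D_(e i) f (w.1 + (z + (w.2 : R) *: e i))|%:E.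
have mF : measurable_fun setT F.
  apply/measurable_EFinP; apply: measurableT_comp => //.
  apply: (measurableT_comp (is_C1_measurable_derive i C1f)).
  apply: measurable_fun_rVP => j; under eq_fun do rewrite !mxE.
  apply: measurable_funD; first exact: (measurableT_comp (measurable_rV_coord j)).
  by apply: measurable_funD => //; exact: measurable_funM.
have F0 w : (0 <= F w)%E by rewrite lee_fin.
have mI : measurable (`[0, t]%classic : set (measurableTypeR R)) by exact: measurable_itv.
apply: (@le_trans _ _ (\int[mu]_(x in B)
    \int[lebesgue_measure]_(s in `[0%R, t]) F (x, s))%E).
  apply: ge0_le_integral => //.
  - exact: measurable_funTS.
  - by apply: measurable_funTS; exact: measurable_integral_in.
  move=> x _; rewrite addrA; apply: le_trans (le_line _ _ C1f t0) _.
  rewrite (eq_integral (fun s => F (x, s)))// => s _.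
  by rewrite /F/= !addrA.
rewrite ge0_integral_in_exchange//.
apply: (@le_trans _ _ (\int[lebesgue_measure]_(s in `[0%R, t]) K%:E)%E).
  apply: ge0_le_integral => //.
  - by move=> s _; exact: integral_ge0.
  - apply: measurable_funTS.
    exact: measurable_integral_in_swap.
  by move=> s _; exact: (fK i (z + (s : R) *: e i)).
rewrite -[X in (X <= _)%E]/(\int[lebesgue_measure]_(s in `[0%R, t]) cst K%:E s)%E.
rewrite integral_cst//= lebesgue_measure_itv/= lte_fin muleC.
case: ltP => [_|]; first by rewrite -EFinB subr0.
by move=> t0'; rewrite mul0e lee_fin mulr_ge0// (K_ge0 i).
Qed.

Let translation_coord i (t : R) z :
  (\int[mu]_(x in B) `|f (x + (z + t *: e i)) - f (x + z)|%:E <= (`|t| * K)%:E)%E.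
Proof.
have [t0|t0] := leP 0 t; first by rewrite (ger0_norm t0); exact: translation_coord_ge0.
rewrite (ltr0_norm t0).
(* A negative displacement is a positive one traversed backwards from the other endpoint. *)
have := @translation_coord_ge0 i (- t) (z + t *: e i).
rewrite oppr_ge0 (ltW t0) scaleNr addrK => /(_ isT).
by under eq_integral do rewrite distrC.
Qed.

(** The displacement is made one coordinate at a time; the base point [z] is general because each
    step starts where the previous one ended. *)
Let translation_seq (s : seq 'I_N) y z :
  (\int[mu]_(x in B) `|f (x + (z + \sum_(i <- s) y ord0 i *: e i)) - f (x + z)|%:E
    <= ((\sum_(i <- s) `|y ord0 i|) * K)%:E)%E.
Proof.
elim: s z => [|i s IH] z.
  rewrite !big_nil mul0r addr0.
  by under eq_integral do rewrite subrr normr0; rewrite integral0.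
rewrite !big_cons.
set a := y ord0 i *: e i; set b := \sum_(_ <- _) _.
apply: (@le_trans _ _ (\int[mu]_(x in B)
  (`|f (x + ((z + a) + b)) - f (x + (z + a))|%:E + `|f (x + (z + a)) - f (x + z)|%:E))%E).
  apply: ge0_le_integral => //.
  - exact: measurable_funTS.
  - by apply: measurable_funTS; exact: emeasurable_funD.
  move=> x _; rewrite -EFinD lee_fin (addrA z a b).
  exact: ler_distD.
rewrite ge0_integralD//; [|exact: measurable_funTS|exact: measurable_funTS].
rewrite mulrDl EFinD addeC.
apply: leeD; [exact: (translation_coord i (y ord0 i) z)|exact: (IH (z + a))].
Qed.

Lemma integral_translation y :
  (\int[mu]_(x in B) `|f (x + y) - f x|%:E <= ((\sum_i `|y ord0 i|) * K)%:E)%E.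
Proof.
have := translation_seq (index_enum 'I_N) y 0.
under eq_integral do rewrite add0r addr0.
suff -> : \sum_i y ord0 i *: e i = y by [].
by rewrite [RHS]row_sum_delta.
Qed.

End translation_estimate.

(** * Local compactness *)

Section subsequences.

(** Finite intersections of the [S m] stay in the filter, so the terms can be chosen increasing with
    [s m] in all of S 0, ..., S m. Two consecutive terms then share [S m], which is what bounds the
    increment from [s m] to [s m.+1]. *)
Lemma filter_subsequence (F : set_system nat) {FF : ProperFilter F}
    (S : nat -> set nat) : nbhs \oo `<=` F -> (forall m, F (S m)) ->
  exists s : nat -> nat, {homo s : m n / (m < n)%N} /\
    forall m, S m (s m) /\ S m (s m.+1).
Proof.
move=> ooF FS.
pose T m := [set n | forall i, (i <= m)%N -> S i n].
have FT m : F (T m).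
  elim: m => [|m IH].
    by apply: filterS (FS 0%N) => n Sn i; rewrite leqn0 => /eqP ->.
  apply: filterS2 IH (FS m.+1) => n Tn Sn i; rewrite leq_eqVlt => /predU1P[->//|].
  exact: Tn.
have pick (a : nat * nat) : exists n, T a.1 n /\ (a.2 < n)%N.
  have Foo : F [set n | (a.2 < n)%N].
    by apply: ooF; exists a.2.+1.
  have := @filter_ex _ _ FF _ (filterI (FT a.1) Foo).
  by move=> [n [? ?]]; exists n.
have [f fP] := choice pick.
pose s := fix s n := if n is m.+1 then f (m.+1, s m) else f (0%N, 0%N).
have sT m : T m (s m) by case: m => [|m]; [exact: (fP (0, 0)%N).1|exact: (fP (m.+1, s m)).1].
exists s; split.
  by apply: homo_ltn; [exact: ltn_trans|move=> i; exact: (fP (i.+1, s i)).2].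
by move=> m; split; [exact: (sT m)|exact: (sT m.+1)].
Qed.

(** Compactness of the segment gives a cluster point, and an ultrafilter converges to each of its
    cluster points. *)
Lemma ultra_bounded_cvg (R : realType) (U : set_system nat) {UU : UltraFilter U}
    (a : nat -> R) (M : R) : (forall n, `|a n| <= M) ->
  exists l : R, a @ U --> l.
Proof.
move=> aM.
have cpt : compact `[- M, M]%classic by exact: segment_compact.
have UM : U (a @^-1` `[- M, M]%classic).
  by apply: filterE => n /=; rewrite in_itv/= -ler_norml; exact: aM.
have [l [_ cl]] := cpt (a @ U) _ UM.
exists l => A lA; have [//|UC] := in_ultra_setVsetC (a @^-1` A) UU.
by have [r [/= + /=]] := cl (~` A) A UC lA.
Qed.

End subsequences.

(** * Approximation by averages over cells *)

Section cell_averages.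
Context {R : realType} (N : nat).
Local Notation RN := 'rV[R]_N.
Local Notation mu := (@lebesgue_rV R N).
Local Notation e := (@evec R N).
Implicit Types (f : RN -> R) (x y z : RN) (i : 'I_N) (k : nat).

(** An open cube containing the difference of any two points of a common cell of mesh [k]. *)
Let Q k : set RN :=
  [set w | forall i, (`]- k.+1%:R^-1, k.+1%:R^-1[%classic : set R) (w ord0 i)].

Let measurable_Q k : measurable (Q k).
Proof.
rewrite (_ : Q k = \bigcap_(i in [set: 'I_N])
  ((fun v : RN => v ord0 i) @^-1` `]- k.+1%:R^-1, k.+1%:R^-1[%classic)).
  apply: fin_bigcap_measurable => // i _.
  by rewrite -[X in measurable X]setTI; apply: measurable_rV_coord.
by apply/seteqP; split => [v h i _|v h i]; apply: h.
Qed.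

Let mu_Q k : mu (Q k) = ((2 * k.+1%:R^-1) ^+ N)%:E.
Proof.
have k0 : 0 < k.+1%:R^-1 :> R by rewrite invr_gt0.
rewrite (lebesgue_rV_box (A := fun=> `]- k.+1%:R^-1, k.+1%:R^-1[%classic))//.
under eq_bigr => i _.
  rewrite lebesgue_measure_itv/= lte_fin gtrN// -EFinB opprK -mulr2n.
  over.
by rewrite -(big_morph _ EFinM erefl) prodr_const card_ord mulr_natl.
Qed.

Definition cell_avg k f j : R :=
  k.+1%:R ^+ N * fine (\int[mu]_(y in cell k j) (f y)%:E).

(** The normalization is the inverse volume of a cell, not of [Q k]. Only translates of [f] occur,
    and no cell: this is what allows Tonelli's theorem and the translation estimate to be
    applied. *)
Definition oscillation k f x : \bar R :=
  ((k.+1%:R ^+ N)%:E * \int[mu]_(w in Q k) `|f x - f (x + w)|%:E)%E.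

Lemma measurable_diff_shift f : measurable_fun setT f ->
  measurable_fun setT (fun z : RN * RN => `|f z.1 - f (z.1 + z.2)|%:E).
Proof.
move=> mf; apply/measurable_EFinP; apply: measurableT_comp => //.
apply: measurable_funB; first exact: (measurableT_comp mf).
exact: (measurableT_comp mf (@measurable_shift2 R N)).
Qed.

Lemma measurable_oscillation k f : measurable_fun setT f ->
  measurable_fun setT (oscillation k f).
Proof.
move=> mf; apply: measurable_funeM.
exact: (measurable_integral_in mu (measurable_Q k) (measurable_diff_shift mf)).
Qed.

Lemma oscillation_ge0 k f x : (0 <= oscillation k f x)%E.
Proof. by apply: mule_ge0; [rewrite lee_fin exprn_ge0|exact: integral_ge0]. Qed.

(** The distance to the average is at most the average of |f x - f y| over the cell; with y = x + w
    the variable [w] stays in [Q k], and the integral is enlarged to all of [Q k]. *)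
Lemma dist_cell_avg k f x : measurable_fun setT f ->
  mu.-integrable (cell k (cell_index k x)) (EFin \o f) ->
  (`|f x - cell_avg k f (cell_index k x)|%:E <= oscillation k f x)%E.
Proof.
move=> mf intf; set D := cell k (cell_index k x) in intf *.
have mD : measurable D by exact: measurable_cell.
have muD : mu D = ((k.+1%:R^-1) ^+ N)%:E by exact: lebesgue_rV_cell.
have k0 : 0 < k.+1%:R ^+ N :> R by rewrite exprn_gt0.
have Dx : D x by exact/cellP.
have intfin : (\int[mu]_(y in D) (f y)%:E)%E \is a fin_num.
  exact: integrable_fin_num intf.
have intc : mu.-integrable D (cst (f x)%:E).
  apply/integrableP; split; first exact: measurable_cst.
  apply: (@le_lt_trans _ _ (`|f x| * k.+1%:R^-1 ^+ N)%:E); last exact: ltry.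
  by rewrite EFinM -muD; have := integral_cst mu mD (`|f x|%:E) => <-.
have -> : `|f x - cell_avg k f (cell_index k x)|%:E =
   ((k.+1%:R ^+ N)%:E * `| \int[mu]_(y in D) ((f x)%:E - (f y)%:E) |)%E.
  have fxE : (\int[mu]_(y in D) (f x)%:E = (f x * k.+1%:R^-1 ^+ N)%:E)%E.
    by rewrite EFinM -muD -integral_cst.
  rewrite integralB// fxE.
  rewrite /cell_avg -[in RHS](fineK intfin) -EFinB abse_EFin -EFinM.
  rewrite -[X in _ = (X * _)%:E](gtr0_norm k0) -normrM mulrBr; congr (`|_ - _|%:E).
  by rewrite mulrCA -exprMn divff// expr1n mulr1.
apply: lee_wpmul2l; first by rewrite lee_fin ltW.
apply: le_trans (le_abse_integral _ _ _) _ => //.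
  by apply: emeasurable_funB; [exact: measurable_cst|
    apply/measurable_EFinP; exact: measurable_funTS].
pose g w : \bar R := (`|f x - f w|%:E * (\1_D w)%:E)%E.
have mg : measurable_fun setT g.
  apply: emeasurable_funM; apply/measurable_EFinP.
    by apply: measurableT_comp => //; exact: measurable_funB.
  exact: measurable_indic.
have -> : (\int[mu]_(y in D) `|(f x)%:E - (f y)%:E| = \int[mu]_w g w)%E.
  rewrite integral_mkcond; apply: eq_integral => w _.
  rewrite patchE /g indicE; case: ifPn => wD; last by rewrite mule0.
  by rewrite mule1.
rewrite -(ge0_integral_rV_shift x)//; last first.
  by move=> w; rewrite /g -EFinM lee_fin mulr_ge0.
rewrite [X in (_ <= X)%E]integral_mkcond; apply: ge0_le_integral => //.
- by move=> w _; rewrite /g -EFinM lee_fin mulr_ge0.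
- exact: (measurableT_comp mg (measurable_rV_shift x)).
- apply/(measurable_restrictT _ (measurable_Q k)); apply: measurable_funTS.
  apply/measurable_EFinP; apply: measurableT_comp => //; apply: measurable_funB => //.
  under eq_fun do rewrite addrC.
  exact: (measurableT_comp mf (measurable_rV_shift x)).
move=> w _; rewrite patchE /g indicE (addrC w x).
have [xwD|xwD] := boolP (x + w \in D); last first.
  by rewrite mule0; case: ifP.
rewrite mule1 ifT//; rewrite inE => i.
have := cell_diam i (set_mem xwD) Dx.
by rewrite mxE addrAC subrr add0r /= in_itv/= ltr_norml.
Qed.

(** After exchanging the integrals, a translation by w in [Q k] costs at most N K / (k+1), each
    coordinate of w being below 1/(k+1). The factor 2^N is the volume of [Q k] divided by that of a
    cell. *)
Lemma integral_oscillation_le k f (B : set RN) (K : R) : is_Ck 1 f ->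
  measurable B -> 0 <= K ->
  (forall i y, (\int[mu]_(x in B) `|'D_(e i) f (x + y)|%:E <= K%:E)%E) ->
  (\int[mu]_(x in B) oscillation k f x <= (2 ^+ N * N%:R * K / k.+1%:R)%:E)%E.
Proof.
move=> C1f mB K0 fK.
have mf := is_C1_measurable C1f.
have mdf := measurable_diff_shift mf.
have mQ := measurable_Q k.
have k0 : 0 < k.+1%:R :> R by [].
rewrite /oscillation ge0_integralZl_EFin//; last 2 first.
- by move=> x _; exact: integral_ge0.
- by apply: measurable_funTS; exact: (measurable_integral_in mu mQ mdf).
have df0 (z : RN * RN) : (0 <= `|f z.1 - f (z.1 + z.2)|%:E)%E by rewrite lee_fin.
have -> := ge0_integral_in_exchange mu mu mB mQ mdf df0.
apply: (@le_trans _ _ ((k.+1%:R ^+ N)%:E *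
    \int[mu]_(w in Q k) cst (N%:R * k.+1%:R^-1 * K)%:E w)%E).
  apply: lee_wpmul2l; first by rewrite lee_fin exprn_ge0.
  apply: ge0_le_integral => //.
  - by move=> w _; exact: integral_ge0.
  - by apply: measurable_funTS; exact: (measurable_integral_in_swap mu mB mdf).
  move=> w Qw /=.
  under eq_integral do rewrite distrC.
  apply: (le_trans (integral_translation C1f mB fK w)).
  rewrite lee_fin ler_wpM2r//.
  rewrite -[N in N%:R]card_ord mulr_natl -sumr_const ler_sum// => i _.
  by have := Qw i; rewrite /= in_itv/= -ltr_norml => /ltW.
have cstE (a : R) : (\int[mu]_(w in Q k) cst a%:E w = (a * (2 / k.+1%:R) ^+ N)%:E)%E.
  by rewrite EFinM -mu_Q integral_cst.
rewrite cstE -!EFinM lee_fin exprMn.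
rewrite [leLHS](_ : _ = 2 ^+ N * N%:R * K / k.+1%:R * (k.+1%:R ^+ N * k.+1%:R^-1 ^+ N)).
  by rewrite -exprMn divff ?gt_eqF// expr1n mulr1.
by ring.
Qed.

End cell_averages.

(** * Subsequences converging almost everywhere *)

Section compactness.
Context {R : realType} (N : nat).
Local Notation RN := 'rV[R]_N.
Local Notation mu := (@lebesgue_rV R N).
Local Notation e := (@evec R N).
Implicit Types (f : RN -> R) (x y z : RN) (i : 'I_N) (k m : nat).

Definition cube m : set RN :=
  [set v | forall i, (`[- m%:R, m%:R]%classic : set R) (v ord0 i)].

Lemma measurable_cube m : measurable (cube m).
Proof.
rewrite (_ : cube m = \bigcap_(i in [set: 'I_N])
  ((fun v : RN => v ord0 i) @^-1` `[- m%:R, m%:R]%classic)).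
  apply: fin_bigcap_measurable => // i _.
  by rewrite -[X in measurable X]setTI; apply: measurable_rV_coord.
by apply/seteqP; split => [v h i _|v h i]; apply: h.
Qed.

Lemma cube_lty m : (mu (cube m) < +oo)%E.
Proof.
rewrite (lebesgue_rV_box (A := fun=> `[- m%:R, m%:R]%classic))//.
rewrite (eq_bigr (fun=> (m%:R - - m%:R)%:E)); last first.
  move=> i _; rewrite lebesgue_measure_itv/= lte_fin -EFinB.
  case: ifPn => //; rewrite -leNgt => h.
  have /eqP -> : m%:R == 0 :> R by move: (ler0n R m) h; lra.
  by rewrite oppr0 subr0.
by rewrite -(big_morph _ EFinM erefl) ltry.
Qed.

Lemma sub_cube m m' : (m <= m')%N -> cube m `<=` cube m'.
Proof.
move=> mm v h i; have := h i; rewrite /= !in_itv/= => /andP[h1 h2].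
have mmR : m%:R <= m'%:R :> R by rewrite ler_nat.
by rewrite (le_trans _ h1) ?lerN2// (le_trans h2).
Qed.

Lemma bigcup_cube : \bigcup_m cube m = setT.
Proof.
rewrite -subTset => v _.
have [m mP] : exists m : nat, forall i, `|v ord0 i| <= m%:R.
  exists (\max_i Num.bound `|v ord0 i|)%N => i.
  apply: (@le_trans _ _ (Num.bound `|v ord0 i|)%:R).
    exact/ltW/archi_boundP.
  by rewrite ler_nat; exact: leq_bigmax.
by exists m => // i; rewrite /= in_itv/= -ler_norml mP.
Qed.

(** Finiteness is needed to intersect, over all cells meeting the cube, the sets of a filter. The
    floors lie between -M and M, and adding M encodes them as ordinals. *)
Lemma finite_cell_index k m :
  exists (G : finType) (J : G -> {ffun 'I_N -> int}),
  forall v, cube m v -> exists g, cell_index k v = J g.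
Proof.
pose M := (m * k.+1)%N.
exists {ffun 'I_N -> 'I_(M + M).+1},
  (fun g : {ffun 'I_N -> 'I_(M + M).+1} => [ffun i => (g i)%:Z - M%:Z]).
move=> v vm; rewrite /cell_index.
have bnd i : - M%:Z <= Num.floor (v ord0 i * k.+1%:R) <= M%:Z.
  have := vm i; rewrite /= in_itv/= => /andP[h1 h2].
  have MR : (M%:Z)%:~R = m%:R * k.+1%:R :> R by rewrite -pmulrn natrM.
  apply/andP; split; first by rewrite floor_ge_int mulrNz MR -mulNr ler_pM2r.
  by rewrite -(@ler_int R) MR; apply: le_trans (floor_le _) _; rewrite ler_pM2r.
exists [ffun i => inord (absz (Num.floor (v ord0 i * k.+1%:R) + M%:Z)%R)].
apply/ffunP => i; rewrite !ffunE; have := bnd i.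
set c := Num.floor _ => cb.
by rewrite inordK; lia.
Qed.

Section rellich.
Variables (r : RN -> R) (phi : nat -> RN -> R) (M : R).
Hypotheses (mr : measurable_fun setT r) (r1 : forall x, 1 <= r x) (M0 : 0 < M).
Hypothesis C1phi : forall n, is_Ck 1 (phi n).
Hypothesis gphi : forall n, gauge mu (cst 1) r (phi n) M.
Hypothesis gdphi :
  forall n i, gauge mu (cst 1) r (fun x => 'D_(e i) (phi n) x) M.

Let mphi n : measurable_fun setT (phi n).
Proof. exact: is_C1_measurable. Qed.

Let K m : R := M * (fine (mu (cube m)) + 1).

Let KE m : (M%:E * (mu (cube m) + 1))%E = (K m)%:E.
Proof. by rewrite /K EFinM EFinD fineK// ge0_fin_numE// cube_lty. Qed.

Let K0 m : 0 <= K m.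
Proof. by rewrite mulr_ge0 ?(ltW M0)// addr_ge0// fine_ge0. Qed.

Let derive_le m n i y :
  (\int[mu]_(x in cube m) `|'D_(e i) (phi n) (x + y)|%:E <= (K m)%:E)%E.
Proof.
rewrite -KE; apply: (gauge_local (u := fun x => 'D_(e i) (phi n) x) y mr r1) => //.
  exact: is_C1_measurable_derive.
exact: measurable_cube.
Qed.

Let cell_int_le n k j :
  (\int[mu]_(x in cell k j) `|(phi n x)%:E| <= M%:E * (mu (cell k j) + 1))%E.
Proof.
have := gauge_local 0 mr r1 (mphi n) M0 (measurable_cell k j) (gphi n).
by under eq_integral do rewrite addr0.
Qed.

Let cell_integrable n k j : mu.-integrable (cell k j) (EFin \o phi n).
Proof.
apply/integrableP; split; first by apply/measurable_EFinP; exact: measurable_funTS.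
by apply: le_lt_trans (cell_int_le n k j) _; rewrite lebesgue_rV_cell -EFinD -EFinM ltry.
Qed.

Let cell_avg_bound k j : exists C : R, forall n, `|cell_avg k (phi n) j| <= C.
Proof.
exists (k.+1%:R ^+ N * (M * (k.+1%:R^-1 ^+ N + 1))) => n.
rewrite /cell_avg normrM ger0_norm ?exprn_ge0// ler_wpM2l ?exprn_ge0//.
have fin : (\int[mu]_(y in cell k j) (phi n y)%:E)%E \is a fin_num.
  by apply: integrable_fin_num (cell_integrable n k j); exact: measurable_cell.
rewrite -lee_fin -abse_EFin fineK//.
apply: le_trans (le_abse_integral _ _ _) _; first exact: measurable_cell.
  by apply/measurable_EFinP; exact: measurable_funTS.
by apply: le_trans (cell_int_le n k j) _; rewrite lebesgue_rV_cell -EFinD -EFinM.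
Qed.

(** A function is compared with its cell averages at the cost of its oscillation, small for a fine
    mesh uniformly in [n]. Along [U] the averages converge, and only finitely many cells meet the
    cube, so one set of [U] makes all of them close to their limits. *)
Let ultra_cauchy (U : set_system nat) {UU : UltraFilter U} m (eps : R) : 0 < eps ->
  exists2 S, U S & forall a b, S a -> S b ->
    (\int[mu]_(x in cube m) `|phi b x - phi a x|%:E <= eps%:E)%E.
Proof.
move=> eps0.
pose A : R := 2 ^+ N * N%:R * K m.
have A0 : 0 <= A by rewrite /A mulr_ge0// mulr_ge0// exprn_ge0.
pose c : R := fine (mu (cube m)).
have c0 : 0 <= c by exact: fine_ge0.
have muc : mu (cube m) = c%:E by rewrite fineK// ge0_fin_numE// cube_lty.
have [k kA] : exists k : nat, A / k.+1%:R <= eps / 4.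
  exists (Num.bound (A / (eps / 4))); rewrite ler_pdivrMr// mulrC -ler_pdivrMr ?divr_gt0//.
  apply: le_trans (ltW (archi_boundP _)) _; first by rewrite !divr_ge0// ltW.
  by rewrite ler_nat.
(* The oscillations of [phi a] and [phi b] take eps/4 each. The averages differ by less than 2 d,
   which over the cube of volume [c] costs at most the remaining eps/2; [c + 1] guards against a
   zero denominator. *)
pose d : R := eps / 4 / (c + 1).
have d0 : 0 < d by rewrite !divr_gt0// ltr_wpDl.
have cvg_avg j : exists l : R, (cell_avg k (phi n) j) @[n --> U] --> l.
  by have [C HC] := cell_avg_bound k j; exact: ultra_bounded_cvg HC.
have [l Hl] := choice cvg_avg.
have [G [J HJ]] := finite_cell_index k m.
exists [set n | forall g, `|l (J g) - cell_avg k (phi n) (J g)| < d].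
  apply: (@filter_forall _ _ (fun g n => `|l (J g) - cell_avg k (phi n) (J g)| < d)).
  by move=> g; have /cvgrPdist_lt/(_ _ d0) := Hl (J g).
move=> a b Sa Sb.
have mcube := measurable_cube m.
have mosc n := measurable_oscillation k (mphi n).
have osc0 n x := oscillation_ge0 k (phi n) x.
apply: (@le_trans _ _ (\int[mu]_(x in cube m)
  ((oscillation k (phi b) x + oscillation k (phi a) x) + (2 * d)%:E))%E).
  apply: ge0_le_integral => //.
  - apply/measurable_EFinP; apply: measurable_funTS; apply: measurableT_comp => //.
    exact: measurable_funB.
  - by apply: measurable_funTS; apply: emeasurable_funD => //; exact: emeasurable_funD.
  move=> x Bx; set j := cell_index k x.
  have [g jg] : exists g, j = J g := HJ x Bx.
  have := Sa g; have := Sb g; rewrite -jg => db da.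
  have ha := dist_cell_avg (mphi a) (cell_integrable a k j).
  have hb := dist_cell_avg (mphi b) (cell_integrable b k j).
  apply: (@le_trans _ _ (`|phi b x - cell_avg k (phi b) j|%:E +
    `|phi a x - cell_avg k (phi a) j|%:E + (2 * d)%:E)%E); last first.
    by apply: leeD => //; apply: leeD.
  rewrite -!EFinD lee_fin.
  move: da db => /=; set u := cell_avg _ _ _; set v := cell_avg _ _ _ => da db.
  rewrite (_ : phi b x - phi a x = (phi b x - v) - (phi a x - u) + ((l j - u) - (l j - v))).
    apply: (le_trans (ler_normD _ _)); apply: lerD; first exact: ler_normB.
    by apply: (le_trans (ler_normB _ _)); lra.
  by ring.
have ge0_d : 0 <= 2 * d by rewrite mulr_ge0// ltW.
have osc_le n := integral_oscillation_le k (C1phi n) mcube (K0 m) (derive_le m n).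
rewrite ge0_integralD//; last 2 first.
- by move=> x _; exact: adde_ge0.
- by apply: measurable_funTS; exact: emeasurable_funD.
rewrite ge0_integralD//; [|exact: measurable_funTS|exact: measurable_funTS].
rewrite (_ : \int[mu]_(x in cube m) (2 * d)%:E = (2 * d * c)%:E)%E; last first.
  by rewrite [in RHS]EFinM -muc -integral_cst.
apply: (@le_trans _ _ ((A / k.+1%:R)%:E + (A / k.+1%:R)%:E + (2 * d * c)%:E)%E).
  by apply: leeD => //; apply: leeD; exact: osc_le.
rewrite -!EFinD lee_fin.
have : 2 * d * c <= eps / 2.
  rewrite (_ : eps / 2 = 2 * d * (c + 1)).
    by apply: ler_wpM2l => //; rewrite lerDl.
  by rewrite /d; field; rewrite gt_eqF// ltr_wpDl.
by move: kA; move: (A / k.+1%:R) (2 * d * c) => u w; lra.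
Qed.

(** One ultrafilter serves all cubes and all meshes, which replaces a diagonal extraction. The
    tolerance 2^-(m+1) on cube m makes the increments summable on each fixed cube, since cube k is
    contained in cube m for m >= k. *)
Lemma rellich_ae : exists s : nat -> nat, {homo s : m n / (m < n)%N} /\
  exists2 v : RN -> R, measurable_fun setT v &
    {ae mu, forall x, phi (s n) x @[n --> \oo] --> v x}.
Proof.
have [U [UU ooU]] := ultraFilterLemma (eventually_filter : ProperFilter \oo).
have eps0 m : 0 < (2 ^+ m.+1)^-1 :> R by rewrite invr_gt0 exprn_gt0.
have HS m : exists S : set nat, U S /\ forall a b, S a -> S b ->
    (\int[mu]_(x in cube m) `|phi b x - phi a x|%:E <= ((2 ^+ m.+1)^-1)%:E)%E.
  by have [S US HSm] := ultra_cauchy (UU := UU) m (eps0 m); exists S.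
have [S HS'] := choice HS.
have [s [s_incr sS]] := filter_subsequence ooU (fun m => (HS' m).1).
exists s; split => //.
apply: (@ae_cvg_summable _ _ _ mu (fun n => phi (s n)) cube).
- by move=> n; exact: mphi.
- exact: measurable_cube.
- exact: bigcup_cube.
move=> k; exists 1 => //; exists k => // m /= km.
rewrite mul1r.
apply: le_trans ((HS' m).2 _ _ (sS m).1 (sS m).2).
apply: ge0_subset_integral => //; [exact: measurable_cube|exact: measurable_cube| |].
  apply/measurable_EFinP; apply: measurable_funTS; apply: measurableT_comp => //.
  exact: measurable_funB.
exact: sub_cube.
Qed.

End rellich.
End compactness.

(** * Closability of the gradient *)

Section vanishing_primitive.
Context {R : realType}.
Local Notation lambda := (@lebesgue_measure R).

(** Almost everywhere the primitive is derivable with derivative G. It vanishes at points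
    arbitrarily close to x on the right, so its value at x is 0 by continuity and its derivative is
    a limit of zero quotients. Only rational endpoints are assumed, so that countably many null sets
    are discarded in the application. *)
Lemma vanishing_primitive_ae0 (G : R -> R) :
  lambda.-integrable `[0, 2] (EFin \o G) ->
  (forall i k : nat, i%:R / k.+1%:R <= 2 :> R ->
    (\int[lambda]_(s in `[0%R, (i%:R / k.+1%:R)%R]) (G s)%:E = 0)%E) ->
  {ae lambda, forall s, `]0, 1[%classic s -> G s = 0}.
Proof.
move=> intG G0.
pose f := G \_ `[0, 2].
have intf : lambda.-integrable setT (EFin \o f).
  rewrite /f -restrict_EFin; apply/integrable_restrict => //=.
  by rewrite setTI.
have locf : locally_integrable setT f.
  exact: integrable_locally.
have intfy y : lambda.-integrable [set` Interval (BLeft 0) (BRight y)] (EFin \o f).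
  exact: (integrableS measurableT).
pose F x := (\int[lambda]_(t in [set` Interval (BLeft 0%R) (BRight x)]) f t)%R.
have FTC : {ae lambda, forall x, (BLeft 0%R < BRight x)%E ->
  derivable F x 1 /\ derive1 F x = f x} := FTC1 intfy locf.
have F0 i k : i%:R / k.+1%:R <= 2 :> R -> F (i%:R / k.+1%:R) = 0.
  move=> ik; transitivity (\int[lambda]_(s in `[0%R, (i%:R / k.+1%:R)%R]) G s)%R.
    apply: eq_Rintegral => s; rewrite inE/= in_itv/= => /andP[s0 sik].
    by rewrite /f patchE mem_set//= in_itv/= s0 (le_trans sik).
  by rewrite /Rintegral G0.
move: FTC; apply: filterS; first exact: (ae_filter_ringOfSetsType lambda).
move=> x H /=; rewrite in_itv/= => /andP[x0 x1].
have /H[dF F'] : (BLeft 0%R < BRight x)%E by rewrite lte_fin.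
have fx : f x = G x by rewrite /f patchE mem_set//= in_itv/= !ltW//; lra.
rewrite -fx -F'.
(* The witness is the first multiple of 1/(k+1) strictly to the right of x. It is at distance at
   most 1/(k+1) < d, and x < 1 keeps it below 2, which is why the integrals are assumed to vanish up
   to 2. *)
have dense_x (d : R) : 0 < d -> exists2 h : R, 0 < h < d & F (h + x) = 0.
  move=> d0.
  have m0 : 0 < Num.min d 1 by rewrite lt_min d0 ltr01.
  have [k _ /(_ _ (leqnn k)) /= kd] := near_infty_natSinv_lt (PosNum m0).
  move: kd; rewrite lt_min => /andP[kd k1].
  have k0 : 0 < k.+1%:R :> R by [].
  pose i := (Num.truncn (x * k.+1%:R)).+1.
  have /andP[i1 i2] : (i.-1)%:R <= x * k.+1%:R < i%:R.
    by apply: truncn_itv; rewrite mulr_ge0// ltW.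
  have i3 : i%:R <= x * k.+1%:R + 1 by rewrite /i -natr1 lerD2r.
  exists (i%:R / k.+1%:R - x).
    rewrite subr_gt0 ltr_pdivlMr// i2/=.
    rewrite ltrBlDr (le_lt_trans _ (_ : k.+1%:R^-1 + x < _)) ?ltrD2r//.
    by rewrite ler_pdivrMr// mulrDl mulVf ?gt_eqF// addrC.
  rewrite subrK F0// ler_pdivrMr// (le_trans i3)//.
  have k1' : 1 <= k.+1%:R :> R by rewrite ler1n.
  have : x * k.+1%:R <= k.+1%:R by rewrite ler_piMl ?ltW.
  by move: k1'; lra.
have Fx : F x = 0.
  apply/eqP/negPn/negP => FxN0.
  have : {for x, continuous F}.
    by apply: differentiable_continuous; exact/derivable1_diffP.
  move/cvgrPdist_lt => /(_ `|F x|); rewrite normr_gt0 => /(_ FxN0).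
  move=> /nbhs_ballP[d /= d0 dP]; have [h /andP[h0 hd] Fh] := dense_x d d0.
  have := dP (h + x); rewrite Fh subr0 ltxx => H'.
  suff : false by []. apply: H'.
  by rewrite /ball/= distrC addrK gtr0_norm.
apply/eqP/negPn/negP => LN0.
have dFx : (fun h : R => h^-1 *: ((F \o shift x) (h *: 1) - F x)) @ 0^' --> derive1 F x.
  by rewrite derive1E; exact: dF.
move/cvgrPdist_lt : dFx => /(_ `|derive1 F x|); rewrite normr_gt0 => /(_ LN0).
move=> /nbhs_ballP[d /= d0 dP]; have [h /andP[h0 hd] Fh] := dense_x d d0.
have := dP h; rewrite /= [h *: 1]mulr1 Fh Fx subrr scaler0 subr0 ltxx => H'.
suff : false by []. apply: H'; last by rewrite gt_eqF.
by rewrite /ball/= sub0r normrN gtr0_norm.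
Qed.

End vanishing_primitive.

Section liminf_facts.
Local Open Scope ereal_scope.
Context (R : realType).

Lemma le_limn_einf (u : nat -> \bar R) (a : \bar R) :
  (\forall n \near \oo, a <= u n) -> a <= limn_einf u.
Proof.
move=> [n0 _ H]; rewrite limn_einf_lim; apply: lime_ge; first exact: is_cvg_einfs.
exists n0 => // n /= n0n; apply: le_ereal_inf_tmp => _ [k /= nk <-].
by apply: H; rewrite /= (leq_trans n0n).
Qed.

(** By Fatou's lemma. Integrals tending to 0 give pointwise convergence only along a subsequence;
    the lower limit avoids extracting one. *)
Lemma limn_einf_ae0 d (T : measurableType d) (mu : {measure set T -> \bar R})
    (D : set T) (h : nat -> T -> \bar R) : measurable D ->
  (forall n, measurable_fun D (h n)) -> (forall n x, 0 <= h n x) ->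
  (\int[mu]_(x in D) h n x) @[n --> \oo] --> 0 ->
  {ae mu, forall x, D x -> limn_einf (h ^~ x) = 0}.
Proof.
move=> mD mh h0 int0.
have mH : measurable_fun D (fun x => limn_einf (h ^~ x)).
  rewrite (_ : (fun x => _) =
      (fun x => - limn_esup ((fun n y => - h n y) ^~ x))); last first.
    apply/funext => x; rewrite -limn_einfN; congr (limn_einf _).
    by apply/funext => n /=; rewrite oppeK.
  apply: measurableT_comp => //; apply: measurable_fun_limn_esup => n.
  exact: measurableT_comp.
apply/(ae_eq_integral_abs _ mD mH)/eqP; rewrite eq_le integral_ge0// andbT.
have H0 x : 0 <= limn_einf (h ^~ x) by apply: le_limn_einf; exact: nearW.
under eq_integral do rewrite gee0_abs//.
apply: le_trans (fatou _ mD mh _) _; first by move=> *; exact: h0.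
by rewrite (cvg_limn_einf_sup int0).1.
Qed.

End liminf_facts.

Section ae_translation.
Context {R : realType} (N : nat).
Local Notation RN := 'rV[R]_N.
Local Notation mu := (@lebesgue_rV R N).

Lemma ae_rV_shift (P : RN -> Prop) (y : RN) :
  {ae mu, forall x, P x} -> {ae mu, forall x, P (x + y)}.
Proof.
move=> [A [mA A0 PA]]; exists ((fun x => x + y) @^-1` A); split.
- by rewrite -[X in measurable X]setTI; exact: measurable_rV_shift.
- by rewrite lebesgue_rV_shift.
- by move=> x /= Px; exact: PA.
Qed.

End ae_translation.

Section closability.
Context {R : realType} (N : nat).
Local Notation RN := 'rV[R]_N.
Local Notation mu := (@lebesgue_rV R N).
Local Notation e := (@evec R N).
Local Notation lambda := (@lebesgue_measure R).
Variables (r g : RN -> R) (phi : nat -> RN -> R) (xi : nat -> R) (i : 'I_N).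
Hypotheses (mr : measurable_fun setT r) (r1 : forall x, 1 <= r x).
Hypothesis C1phi : forall n, is_Ck 1 (phi n).
Hypotheses (mg : measurable_fun setT g) (xi_gt0 : forall n, 0 < xi n).
Hypothesis xi_cvg0 : xi @ \oo --> 0.
Hypothesis phi_cvg0 : {ae mu, forall x, phi n x @[n --> \oo] --> 0}.

Let u n x := 'D_(e i) (phi n) x - g x.

Hypothesis gauge_u : forall n, gauge mu (cst 1) r (u n) (xi n).

Let mu' n : measurable_fun setT (u n).
Proof. by apply: measurable_funB => //; exact: is_C1_measurable_derive. Qed.

(** Every line parallel to e_i is parametrized from each of its points, so the starting point ranges
    over the whole space with the measure [mu]. *)
Let line (w : RN * measurableTypeR R) : RN := w.1 + (w.2 : R) *: e i.

Let measurable_line : measurable_fun setT line.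
Proof.
apply: measurable_fun_rVP => j; under eq_fun do rewrite !mxE.
apply: measurable_funD; first exact: (measurableT_comp (measurable_rV_coord j)).
exact: measurable_funM.
Qed.

Let measurable_line1 x : measurable_fun [set: measurableTypeR R]
  (fun s : measurableTypeR R => line (x, s)).
Proof.
apply: measurable_fun_rVP => j; under eq_fun do rewrite /line /= !mxE.
by apply: measurable_funD => //; exact: measurable_funM.
Qed.

Let U n (w : RN * measurableTypeR R) : \bar R := `|u n (line w)|%:E.

Let mU n : measurable_fun setT (U n).
Proof.
apply/measurable_EFinP; apply: measurableT_comp => //.
exact: (measurableT_comp (mu' n) measurable_line).
Qed.

Let U0 n w : (0 <= U n w)%E. Proof. by rewrite lee_fin. Qed.

Let I2 : set (measurableTypeR R) := `[0, 2]%classic.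

Let mI2 : measurable I2. Proof. exact: measurable_itv. Qed.

Let h n x := (\int[lambda]_(s in I2) U n (x, s))%E.

Let mh n : measurable_fun setT (h n).
Proof. exact: (measurable_integral_in lambda mI2 (mU n) (U0 n)). Qed.

Let h0 n x : (0 <= h n x)%E. Proof. exact: integral_ge0. Qed.

Let integral_h n m :
  (\int[mu]_(x in cube m) h n x <= (xi n * (fine (mu (cube m)) + 1) * 2)%:E)%E.
Proof.
have mc : measurable (cube m : set RN) by exact: measurable_cube.
rewrite /h (ge0_integral_in_exchange mu lambda mc mI2 (mU n) (U0 n)).
set K := xi n * (fine (mu (cube m)) + 1).
have KE : (K%:E = (xi n)%:E * (mu (cube m) + 1))%E.
  by rewrite /K EFinM EFinD fineK// ge0_fin_numE// cube_lty.
apply: (@le_trans _ _ (\int[lambda]_(s in I2) cst K%:E s)%E).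
  apply: ge0_le_integral => //.
  - by move=> s _; exact: integral_ge0.
  - apply: measurable_funTS.
    exact: (measurable_integral_in_swap mu mc (mU n) (U0 n)).
  move=> s _ /=; rewrite KE.
  exact: (gauge_local ((s : R) *: e i) mr r1 (mu' n) (xi_gt0 n) mc (gauge_u n)).
by rewrite integral_cst//= /I2 lebesgue_measure_itv/= lte_fin ltr0n/= -EFinB subr0 -EFinM.
Qed.

Let h_liminf0 : {ae mu, forall x, limn_einf (h ^~ x) = 0%E}.
Proof.
suff : {ae mu, forall x m, cube m x -> limn_einf (h ^~ x) = 0%E}.
  apply: filterS => x H; have [m _ xm] : (\bigcup_m cube m) x by rewrite bigcup_cube.
  exact: H xm.
apply/ae_foralln => m; apply: limn_einf_ae0.
- exact: measurable_cube.
- by move=> n; exact: measurable_funTS.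
- exact: h0.
apply: (@squeeze_cvge _ _ _ _ (cst 0%E) _
  (fun n => (xi n * (fine (mu (cube m)) + 1) * 2)%:E)).
- by apply: nearW => n; rewrite integral_h andbT integral_ge0.
- exact: cvg_cst.
apply: cvg_EFin; first exact: nearW.
rewrite -[X in _ --> X](mul0r 2); apply: cvgMl.
by rewrite -[X in _ --> X](mul0r (fine (mu (cube m)) + 1)); exact: cvgMl.
Qed.

(** The index 0 suffices: it makes [g] integrable on the segment, as the difference of the
    continuous derivative of [phi 0] and of [u 0]. *)
Let h_fin : {ae mu, forall x, h 0%N x \is a fin_num}.
Proof.
suff : {ae mu, forall x m, cube m x -> h 0%N x \is a fin_num}.
  apply: filterS => x H; have [m _ xm] : (\bigcup_m cube m) x by rewrite bigcup_cube.
  exact: H xm.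
apply/ae_foralln => m; have mc : measurable (cube m : set RN) by exact: measurable_cube.
apply: (integrable_ae mc); apply/integrableP; split; first exact: measurable_funTS.
under eq_integral do rewrite gee0_abs//.
by apply: le_lt_trans (integral_h 0 m) _; exact: ltry.
Qed.

Let measurable_comp_line x (f : RN -> R) : measurable_fun setT f ->
  measurable_fun [set: measurableTypeR R]
    (fun s : measurableTypeR R => f (line (x, s))).
Proof. by move=> mf; exact: (measurableT_comp mf (measurable_line1 x)). Qed.

Let integrable_derive_line n x (t : R) :
  lambda.-integrable `[0%R, t] (fun s : R => ('D_(e i) (phi n) (line (x, s)))%:E).
Proof.
apply: continuous_compact_integrable; first exact: segment_compact.
apply: continuous_subspaceT.
exact: (continuous_line ((C1phi n).2 i).2).
Qed.

Let integrable_u_line n x (t : R) : t <= 2 -> h n x \is a fin_num ->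
  lambda.-integrable `[0%R, t] (fun s : R => (u n (line (x, s)))%:E).
Proof.
move=> t2 hfin; apply: (@integrableS _ _ _ _ I2) => //.
  by move=> s; rewrite /I2 /= !in_itv/= => /andP[-> st]; rewrite (le_trans st).
apply/integrableP; split.
  by apply/measurable_EFinP; apply: measurable_funTS; exact: measurable_comp_line.
by move: hfin; rewrite ge0_fin_numE.
Qed.

Let integral_g_line_le n x (t : R) : 0 < t <= 2 -> h n x \is a fin_num ->
  (`| \int[lambda]_(s in `[0%R, t]) (g (line (x, s)))%:E | <=
   `|phi n (x + t *: e i) - phi n x|%:E + h n x)%E.
Proof.
move=> /andP[t0 t2] hfin.
have -> : (\int[lambda]_(s in `[0%R, t]) (g (line (x, s)))%:E =
  \int[lambda]_(s in `[0%R, t]) (('D_(e i) (phi n) (line (x, s)))%:E -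
    (u n (line (x, s)))%:E))%E.
  by apply: eq_integral => s _; rewrite -EFinB /u opprB addrC subrK.
rewrite integralB//; last exact: integrable_u_line.
have -> : (\int[lambda]_(s in `[0%R, t]) ('D_(e i) (phi n) (line (x, s)))%:E =
  (phi n (x + t *: e i) - phi n x)%:E)%E by exact: (integral_line x i (C1phi n) t0).
apply: le_trans (lee_abs_sub _ _) _.
apply: leeD => //; apply: le_trans (le_abse_integral _ _ _) _ => //.
  by apply/measurable_EFinP; apply: measurable_funTS; exact: measurable_comp_line.
apply: ge0_subset_integral => //.
  by apply: measurable_funTS; apply/measurable_EFinP;
    apply: measurableT_comp => //; exact: measurable_comp_line.
by move=> s; rewrite /I2 /= !in_itv/= => /andP[-> st]; rewrite (le_trans st).
Qed.

(** For large [n] the endpoint values of [phi n] contribute less than [eps], so the modulus of the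
    integral minus [eps] is a lower bound of all [h n x], hence of their lower limit 0. *)
Let integral_g_line0 x (t : R) : 0 <= t <= 2 -> limn_einf (h ^~ x) = 0%E ->
  phi n x @[n --> \oo] --> 0 -> phi n (x + t *: e i) @[n --> \oo] --> 0 ->
  (\int[lambda]_(s in `[0%R, t]) (g (line (x, s)))%:E = 0)%E.
Proof.
move=> /andP[+ t2] H0 cx cxt; rewrite le_eqVlt => /predU1P[<-|t0].
  by rewrite set_itv1 integral_set1.
set J := (\int[_]_(_ in _) _)%E.
apply/eqP; rewrite -abse_eq0 eq_le abse_ge0 andbT.
apply/lee_addgt0Pr => eps eps0; rewrite add0e.
have cd : `|phi n (x + t *: e i) - phi n x| @[n --> \oo] --> 0.
  by rewrite -[X in _ --> X](normr0 R) -[X in `|X|](subrr 0);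
    apply: cvg_norm; exact: cvgB.
have near_d : \forall n \near \oo, `|phi n (x + t *: e i) - phi n x| < eps.
  by move/cvgr_lt : cd; apply.
rewrite -[leRHS]adde0 -leeBlDl//.
rewrite -[leRHS]H0; apply: le_limn_einf.
apply: filterS near_d => n dn; rewrite leeBlDl//.
have [hfin|] := boolP (h n x \is a fin_num).
  apply: le_trans (integral_g_line_le _ hfin) _; first by rewrite t0.
  by apply: leeD => //; rewrite lee_fin ltW.
(* If [h n x] is infinite the bound is trivial. *)
by rewrite ge0_fin_numE// -leNgt leye_eq => /eqP ->; rewrite addey// leey.
Qed.

Lemma derive_closable : {ae mu, forall x, g x = 0}.
Proof.
(* Restricting to rational displacements keeps the exceptional set null. *)
have phi_shift : {ae mu, forall x a b,
    phi n (x + (a%:R / b.+1%:R) *: e i) @[n --> \oo] --> (0 : R)}.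
  apply/ae_foralln => a; apply/ae_foralln => b.
  exact: (ae_rV_shift ((a%:R / b.+1%:R) *: e i) phi_cvg0).
have line0 : {ae mu, forall x,
    (\int[lambda]_(s in `]0%R, 1%R[) `|g (line (x, s))|%:E = 0)%E}.
  have good : {ae mu, forall x, limn_einf (h ^~ x) = 0%E /\ h 0%N x \is a fin_num}.
    by apply: filterS2 h_liminf0 h_fin => x; split.
  apply: filterS3 phi_cvg0 phi_shift good => x cx cxs [H0 hfin].
  have intg : lambda.-integrable I2 (fun s : R => (g (line (x, s)))%:E).
    have -> : (fun s : R => (g (line (x, s)))%:E) =
        (fun s : R => ('D_(e i) (phi 0%N) (line (x, s)))%:E - (u 0 (line (x, s)))%:E)%E.
      by apply/funext => s; rewrite -EFinB /u opprB addrC subrK.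
    apply: integrableB => //; first exact: (integrable_derive_line 0 x 2).
    exact: (integrable_u_line (lexx 2) hfin).
  have gline0 := vanishing_primitive_ae0 (G := fun s => g (line (x, s))) intg.
  have {}gline0 : {ae lambda, forall s, `]0, 1[%classic s -> g (line (x, s)) = 0}.
    by apply: gline0 => a b ab2; apply: integral_g_line0; rewrite ?divr_ge0.
  rewrite (ae_eq_integral (cst 0%E))//.
  - by rewrite integral0.
  - apply/measurable_EFinP; apply: measurable_funTS.
    by apply: measurableT_comp => //; exact: measurable_comp_line.
  - move: gline0; apply: filterS; first exact: (ae_filter_ringOfSetsType lambda).
    by move=> s Hs sI; rewrite Hs// normr0.
pose F (w : RN * measurableTypeR R) : \bar R := `|g (line w)|%:E.
have mF : measurable_fun setT F.
  apply/measurable_EFinP; apply: measurableT_comp => //.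
  exact: (measurableT_comp mg measurable_line).
have F0 w : (0 <= F w)%E by rewrite lee_fin.
pose I1 : set (measurableTypeR R) := `]0, 1[%classic.
have mI1 : measurable I1 by exact: measurable_itv.
have int0 : (\int[mu]_(x in setT) \int[lambda]_(s in I1) F (x, s) = 0)%E.
  rewrite (ae_eq_integral (cst 0%E))//.
  - by rewrite integral0.
  - exact: (measurable_integral_in lambda mI1 mF F0).
  - by apply: filterS line0 => x H _.
have intg0 : (\int[mu]_x `|(g x)%:E| = 0)%E.
  (* After the exchange, the inner integral over the whole space does not depend on [s], by
     translation invariance; as [s] runs over an interval of length 1, the double integral is
     exactly the L^1 norm of [g]. *)
  rewrite -int0 (ge0_integral_in_exchange mu lambda measurableT mI1 mF F0).
  rewrite [RHS](eq_integral (cst (\int[mu]_x `|(g x)%:E|)%E)); last first.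
    move=> s _.
    have mabs : measurable_fun setT (fun y => `|g y|%:E).
      by apply/measurable_EFinP; exact: measurableT_comp.
    have abs0 y : (0 <= `|g y|%:E)%E by rewrite lee_fin.
    exact: (ge0_integral_rV_shift ((s : R) *: e i) mabs abs0).
  by rewrite integral_cst//= /I1 lebesgue_measure_itv/= lte_fin ltr01 -EFinB subr0 mule1.
have := (ae_eq_integral_abs mu measurableT (f := fun x => (g x)%:E)
  ((measurable_EFinP _ _).2 mg)).1 intg0.
by apply: filterS => x /(_ I) [].
Qed.

End closability.

(** * The completion of the test functions *)

Section luxemburg_facts.
Context {R : realType} (N : nat).
Local Notation RN := 'rV[R]_N.
Local Notation mu := (@lebesgue_rV R N).
Implicit Types (u f r : RN -> R).

Lemma modularE r u : modular r u = wmod mu (cst 1) r u.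
Proof. by rewrite /modular /wmod; under [in RHS]eq_integral do rewrite mul1r. Qed.

Lemma modular_ae_eq r r' u : measurable_fun setT r -> measurable_fun setT r' ->
  measurable_fun setT u -> {ae mu, forall x, r x = r' x} ->
  modular r u = modular r' u.
Proof.
move=> mr mr' mu' rr'; apply: ae_eq_integral => //.
- apply/measurable_EFinP; apply: measurable_powR2 => //; exact: measurableT_comp.
- apply/measurable_EFinP; apply: measurable_powR2 => //; exact: measurableT_comp.
- by apply: filterS rr' => x -> _.
Qed.

(** Allows estimates proved for an exponent with bounds at every point to be used for one that
    equals it almost everywhere. *)
Lemma luxemburg_le r r' u xi : measurable_fun setT r -> measurable_fun setT r' ->
  measurable_fun setT u -> {ae mu, forall x, r x = r' x} ->
  0 < xi -> gauge mu (cst 1) r' u xi -> (luxemburg r u <= xi%:E)%E.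
Proof.
move=> mr mr' mu' rr' xi0 gu; apply: ereal_inf_lbound; exists xi => //; split => //.
rewrite (modular_ae_eq mr mr' _ rr') ?modularE//; exact: measurable_funM.
Qed.

Lemma luxemburg_ge0 r u : (0 <= luxemburg r u)%E.
Proof. by apply: le_ereal_inf_tmp => _ [xi [xi0 _] <-]; rewrite lee_fin ltW. Qed.

Lemma luxemburg_cvg0 (T : Type) (F : set_system T) {FF : Filter F} r
    (u : T -> RN -> R) :
  (forall eps : R, 0 < eps -> \forall t \near F, (luxemburg r (u t) <= eps%:E)%E) ->
  luxemburg r (u t) @[t --> F] --> 0%E.
Proof.
move=> H.
have Hlt (eps : R) : 0 < eps -> \forall t \near F, (luxemburg r (u t) < eps%:E)%E.
  move=> eps0; have eps2 : 0 < eps / 2 by rewrite divr_gt0.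
  apply: filterS (H _ eps2) => t /le_lt_trans; apply.
  by rewrite lte_fin ltr_pdivrMr// mulr_natr mulr2n ltrDr.
apply/fine_cvgP; split.
  apply: filterS (Hlt 1 ltr01) => t ht.
  by rewrite ge0_fin_numE ?luxemburg_ge0// (lt_trans ht)// ltry.
apply/cvgrPdist_lt => eps eps0; apply: filterS (Hlt eps eps0) => t ht.
have fin : luxemburg r (u t) \is a fin_num.
  by rewrite ge0_fin_numE ?luxemburg_ge0// (lt_trans ht)// ltry.
rewrite sub0r normrN ger0_norm ?fine_ge0 ?luxemburg_ge0//.
by rewrite -lte_fin fineK.
Qed.

End luxemburg_facts.

Section test_functions.
Context {R : realType} (N : nat).
Local Notation RN := 'rV[R]_N.
Local Notation mu := (@lebesgue_rV R N).
Local Notation e := (@evec R N).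
Implicit Types (f g : RN -> R).

Lemma derivable_lin (a : R) f g x i : derivable f x (e i) -> derivable g x (e i) ->
  derivable (fun y => a * f y + g y) x (e i).
Proof.
move=> df dg; rewrite (_ : (fun y => _) = a *: f + g)//.
by apply: derivableD => //; exact: derivableZ.
Qed.

Lemma derive_lin (a : R) f g x i : derivable f x (e i) -> derivable g x (e i) ->
  'D_(e i) (fun y => a * f y + g y) x = a * 'D_(e i) f x + 'D_(e i) g x.
Proof.
move=> df dg; rewrite (_ : (fun y => _) = a *: f + g)//.
by rewrite deriveD ?deriveZ//; exact: derivableZ.
Qed.

Lemma is_Ck_lin k (a : R) f g : is_Ck k f -> is_Ck k g ->
  is_Ck k (fun x => a * f x + g x).
Proof.
have cont f' g' : continuous f' -> continuous g' ->
    continuous (fun x : RN => a * f' x + g' x).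
  by move=> cf cg x; exact: (cvgD (cvgM (cvg_cst a) (cf x)) (cg x)).
elim: k f g => [|k IH] f g; first exact: cont.
move=> [cf df] [cg dg]; split; first exact: cont.
move=> i; split.
  by move=> x; apply: derivable_lin; [exact: (df i).1|exact: (dg i).1].
rewrite (_ : (fun x => _) = (fun x => a * 'D_(e i) f x + 'D_(e i) g x)).
  by apply: IH; [exact: (df i).2|exact: (dg i).2].
by apply/funext => x; rewrite derive_lin//; [exact: (df i).1|exact: (dg i).1].
Qed.

Lemma Cc_infty_lin (a : R) f g : f \in @Cc_infty R N -> g \in @Cc_infty R N ->
  (fun x => a * f x + g x) \in @Cc_infty R N.
Proof.
rewrite !inE => -[Cf cf] [Cg cg]; split; first by move=> k; exact: is_Ck_lin.
apply: (@subclosed_compact _ _ (closure [set x | f x != 0] `|` closure [set x | g x != 0])).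
- exact: closed_closure.
- exact: compactU.
- rewrite -closureU => y cy U yU; have [x [fgx Ux]] := cy U yU.
  exists x; split=> //; move: fgx => /=.
  by have [->|f0 _] := eqVneq (f x) 0; [rewrite mulr0 add0r; right|left].
Qed.

Lemma Cc_infty0 : (fun=> 0) \in @Cc_infty R N.
Proof.
rewrite inE; split.
  elim=> [|k IH]; first exact: (@cst_continuous RN R).
  split; first exact: (@cst_continuous RN R).
  move=> i; split=> [x|]; first exact: derivable_cst.
  by rewrite (_ : (fun x => _) = fun=> 0)//; apply/funext => x; rewrite derive_cst.
rewrite (_ : [set x | _] = set0) ?closure0; first exact: compact0.
by apply/seteqP; split => x //=; rewrite eqxx.
Qed.

Lemma Cc_inftyB f g : f \in @Cc_infty R N -> g \in @Cc_infty R N ->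
  (fun x => f x - g x) \in @Cc_infty R N.
Proof.
move=> Cf Cg; rewrite (_ : (fun x => _) = (fun x => (-1) * g x + f x)).
  exact: Cc_infty_lin.
by apply/funext => x; rewrite mulN1r addrC.
Qed.

Lemma Cc_infty_C1 f : f \in @Cc_infty R N -> is_Ck 1 f.
Proof. by rewrite inE => -[/(_ 1%N)]. Qed.

Lemma enormZ (a : R) (v : RN) : enorm (a *: v) = `|a| * enorm v.
Proof.
rewrite /enorm (eq_bigr (fun i => a ^+ 2 * v ord0 i ^+ 2)); last first.
  by move=> i _; rewrite mxE exprMn.
by rewrite -mulr_sumr sqrtrM ?sqr_ge0// sqrtr_sqr.
Qed.

Lemma enorm_ge0 (v : RN) : 0 <= enorm v. Proof. exact: sqrtr_ge0. Qed.

Lemma coord_le_enorm (v : RN) i : `|v ord0 i| <= enorm v.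
Proof.
rewrite -sqrtr_sqr ler_sqrt ?sumr_ge0// => [|j _]; last exact: sqr_ge0.
by rewrite (bigD1 i)//= lerDl sumr_ge0// => j _; exact: sqr_ge0.
Qed.

Lemma enorm_cvg (w : nat -> RN) (v : RN) :
  (forall i, w n ord0 i @[n --> \oo] --> v ord0 i) ->
  enorm (w n) @[n --> \oo] --> enorm v.
Proof.
move=> wv; apply: (continuous_cvg _ (@sqrt_continuous R _)).
apply: cvg_big => [|i _]; first exact: add_continuous.
exact: (continuous_cvg _ (@exprn_continuous _ 2 _) (wv i)).
Qed.

End test_functions.

Section energy.
Context {R : realType} (N : nat).
Local Notation RN := 'rV[R]_N.
Local Notation mu := (@lebesgue_rV R N).
Local Notation e := (@evec R N).
Variables (p V : RN -> R) (v0 : R).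
Hypotheses (mp : measurable_fun setT p) (p1 : forall x, 1 <= p x).
Hypotheses (mV : measurable_fun setT V) (v0_gt0 : 0 < v0).
Hypothesis v0V : forall x, v0 <= V x.
Implicit Types (f g u : RN -> R) (xi : R).

Let V_gt0 x : 0 < V x. Proof. exact: lt_le_trans (v0V x). Qed.

Let V0 x : 0 <= V x. Proof. exact: ltW. Qed.

(** From V >= v0 one gets 1 <= V / v0; the maximum with 1 is required to absorb the factor into the
    scale by [gauge_weight]. *)
Definition weight_const : R := Num.max 1 v0^-1.

Lemma weight_const_ge1 : 1 <= weight_const. Proof. by rewrite le_max lexx. Qed.

Lemma gauge_weight_const u xi : measurable_fun setT u -> 0 < xi ->
  gauge mu V p u xi -> gauge mu (cst 1) p u (weight_const * xi).
Proof.
move=> mu'; apply: gauge_weight => //; first exact: weight_const_ge1.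
move=> x; apply: (@le_trans _ _ (v0^-1 * v0)); first by rewrite mulVf ?gt_eqF.
apply: ler_pM => //; rewrite ?invr_ge0 ?(ltW v0_gt0)//.
by rewrite le_max lexx orbT.
Qed.

Let energy_density f xi x : R :=
  enorm (xi^-1 *: grad f x) `^ p x + V x * `|f x / xi| `^ p x.

(** The modular behind [normX] at scale [xi]: a value at most 1 plays for gradient and function
    together the role of [gauge]. *)
Definition energy f xi : \bar R := (\int[mu]_x (energy_density f xi x)%:E)%E.

Let density_ge0 f xi x : 0 <= energy_density f xi x.
Proof. by rewrite addr_ge0// ?powR_ge0// mulr_ge0// powR_ge0. Qed.

Let measurable_enorm_grad f xi : is_Ck 1 f ->
  measurable_fun setT (fun x => enorm (xi^-1 *: grad f x)).
Proof.
move=> C1f; apply: (@measurableT_comp _ _ _ _ _ _ (@Num.sqrt R)).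
  by apply: continuous_measurable_fun; exact: sqrt_continuous.
apply: measurable_sum => i; apply: measurable_funX.
under eq_fun do rewrite !mxE.
by apply: measurable_funM => //; exact: is_C1_measurable_derive.
Qed.

Let measurable_enorm_powR f xi : is_Ck 1 f ->
  measurable_fun setT (fun x => enorm (xi^-1 *: grad f x) `^ p x).
Proof. by move=> C1f; apply: measurable_powR2 => //; exact: measurable_enorm_grad. Qed.

Let measurable_wmod_div f xi : is_Ck 1 f ->
  measurable_fun setT (fun x => V x * `|f x / xi| `^ p x).
Proof.
move=> C1f; apply/measurable_EFinP.
have mf : measurable_fun setT (fun x => f x / xi).
  by apply: measurable_funM => //; exact: is_C1_measurable.
exact: (measurable_wmod mV mp mf).
Qed.

Let measurable_density f xi : is_Ck 1 f ->
  measurable_fun setT (energy_density f xi).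
Proof.
by move=> C1f; apply: measurable_funD;
  [exact: measurable_enorm_powR|exact: measurable_wmod_div].
Qed.

Let p0 x : 0 <= p x. Proof. exact: le_trans (p1 x). Qed.

Lemma le_energy f xi eta : is_Ck 1 f -> 0 < xi -> xi <= eta ->
  (energy f eta <= energy f xi)%E.
Proof.
move=> C1f xi0 xieta; have eta0 : 0 < eta by exact: lt_le_trans xieta.
have inv_le : eta^-1 <= xi^-1 by rewrite lef_pV2 ?posrE.
apply: ge0_le_integral => //.
- by move=> x _; rewrite lee_fin.
- by apply/measurable_EFinP; exact: measurable_density.
- by apply/measurable_EFinP; exact: measurable_density.
move=> x _; rewrite lee_fin lerD//.
  apply: ge0_ler_powR; rewrite ?nnegrE ?enorm_ge0// !enormZ ler_wpM2r ?enorm_ge0//.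
  by rewrite !gtr0_norm ?invr_gt0.
rewrite ler_wpM2l//; apply: ge0_ler_powR; rewrite ?nnegrE// !normrM ler_wpM2l//.
by rewrite !gtr0_norm ?invr_gt0.
Qed.

Lemma energy_gauge f xi : is_Ck 1 f -> (energy f xi <= 1)%E -> gauge mu V p f xi.
Proof.
move=> C1f; apply: le_trans; apply: ge0_le_integral => //.
- by move=> x _; rewrite lee_fin mulr_ge0// powR_ge0.
- by apply/measurable_EFinP; exact: measurable_wmod_div.
- by apply/measurable_EFinP; exact: measurable_density.
by move=> x _; rewrite lee_fin lerDr powR_ge0.
Qed.

Lemma energy_gauge_derive f xi i : is_Ck 1 f -> (energy f xi <= 1)%E ->
  gauge mu (cst 1) p (fun x => 'D_(e i) f x) xi.
Proof.
move=> C1f; apply: le_trans; apply: ge0_le_integral => //.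
- by move=> x _; rewrite lee_fin mul1r powR_ge0.
- have mdf : measurable_fun setT (fun x => 'D_(e i) f x / xi).
    by apply: measurable_funM => //; exact: is_C1_measurable_derive.
  exact: (measurable_wmod _ mp mdf).
- by apply/measurable_EFinP; exact: measurable_density.
move=> x _; rewrite lee_fin mul1r.
apply: (@le_trans _ _ (enorm (xi^-1 *: grad f x) `^ p x)).
  apply: ge0_ler_powR; rewrite ?nnegrE ?enorm_ge0//.
  have := coord_le_enorm (xi^-1 *: grad f x) i.
  by rewrite !mxE mulrC.
by rewrite lerDl mulr_ge0// powR_ge0.
Qed.

(** Lower semicontinuity of the norm of X under almost everywhere convergence of functions and
    gradients, by Fatou's lemma. *)
Lemma energy_cvg (f : nat -> RN -> R) g xi : (forall n, is_Ck 1 (f n)) ->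
  is_Ck 1 g -> {ae mu, forall x, f n x @[n --> \oo] --> g x} ->
  (forall i, {ae mu, forall x, 'D_(e i) (f n) x @[n --> \oo] --> 'D_(e i) g x}) ->
  (\forall n \near \oo, (energy (f n) xi <= 1)%E) -> (energy g xi <= 1)%E.
Proof.
move=> C1f C1g fg dfg fE.
apply: (@fatou_ae _ _ _ mu (fun n x => (energy_density (f n) xi x)%:E)) => //.
- by move=> n; apply/measurable_EFinP; exact: measurable_density.
- by move=> n x; rewrite lee_fin.
- by apply/measurable_EFinP; exact: measurable_density.
- by move=> x; rewrite lee_fin.
have dfg' : {ae mu, forall x, forall i, 'D_(e i) (f n) x @[n --> \oo] --> 'D_(e i) g x}.
  apply: (@filter_forall _ _ (fun i x => 'D_(e i) (f n) x @[n --> \oo] --> 'D_(e i) g x)).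
  exact: dfg.
apply: filterS2 fg dfg' => x fgx dfgx; apply: cvg_EFin; first exact: nearW.
apply: cvgD.
  apply: powR_cvg => //; first by move=> n; exact: enorm_ge0.
  apply: enorm_cvg => i; under eq_fun do rewrite !mxE.
  by rewrite !mxE; apply: cvgM; [exact: cvg_cst|exact: dfgx].
apply: cvgM; first exact: cvg_cst.
apply: powR_cvg => //; apply: cvg_norm; apply: cvgM; [exact: fgx|exact: cvg_cst].
Qed.

End energy.

(** * Functions representing the elements of the completion *)

Section representatives.
Context {R : realType} (N : nat).
Local Notation RN := 'rV[R]_N.
Local Notation mu := (@lebesgue_rV R N).
Local Notation e := (@evec R N).
Variables (p V : RN -> R) (v0 P : R).
Hypotheses (mp : measurable_fun setT p) (p1 : forall x, 1 <= p x).
Hypothesis pP : forall x, p x <= P.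
Hypotheses (mV : measurable_fun setT V) (v0_gt0 : 0 < v0).
Hypothesis v0V : forall x, v0 <= V x.
Variables (X : completeNormedModType R) (iota : (RN -> R) -> X).
Hypothesis X_completion : is_completion p V iota.
Implicit Types (f g u v : RN -> R) (xi : R) (z : X) (x : RN) (i : 'I_N).

Local Notation Cc := (@Cc_infty R N).
Local Notation c0 := (weight_const v0).

Let V_gt0 x : 0 < V x. Proof. exact: lt_le_trans (v0V x). Qed.

Let V0 x : 0 <= V x. Proof. exact: ltW. Qed.

Let c0_gt0 : 0 < c0. Proof. exact: lt_le_trans (weight_const_ge1 _). Qed.

(** The rate at which the increments of an approximating sequence become summable in
    [ae_cvg_summable]. *)
Let delta (n : nat) : R := (2 ^+ n.+1)^-1.

Let delta_gt0 n : 0 < delta n. Proof. by rewrite invr_gt0 exprn_gt0. Qed.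

Let delta_le m n : (m <= n)%N -> delta n <= delta m.
Proof. by move=> mn; rewrite lef_pV2 ?posrE ?exprn_gt0// ler_eXn2l// ?ltr1n. Qed.

Let delta_cvg0 : delta @ \oo --> 0.
Proof.
have := @cvg_geometric R (2^-1) (2^-1).
rewrite gtr0_norm ?invr_gt0// invf_lt1// ltr1n => /(_ isT).
apply: cvg_trans; apply: near_eq_cvg; apply: nearW => n.
by rewrite /delta /geometric /= exprS invfM exprVn.
Qed.

Lemma iota_lin (a : R) f g : f \in Cc -> g \in Cc ->
  iota (fun x => a * f x + g x) = a *: iota f + iota g.
Proof. by move=> Cf Cg; case: X_completion => + _ _; exact. Qed.

Lemma iotaB f g : f \in Cc -> g \in Cc -> iota (fun x => f x - g x) = iota f - iota g.
Proof.
move=> Cf Cg; rewrite (_ : (fun x => _) = (fun x => (-1) * g x + f x)).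
  by rewrite iota_lin// scaleN1r addrC.
by apply/funext => x; rewrite mulN1r addrC.
Qed.

Lemma iota0 : iota (fun=> 0) = 0.
Proof.
have := iota_lin (-1) (Cc_infty0 N) (Cc_infty0 N); rewrite scaleN1r addNr => <-.
by congr iota; apply/funext => x; rewrite mulr0 addr0.
Qed.

(** The strict inequality provides an admissible scale below [xi] although the infimum need not be
    attained; the energy decreases as the scale grows. *)
Lemma iota_energy f xi : f \in Cc -> `|iota f| < xi -> (energy p V f xi <= 1)%E.
Proof.
move=> Cf; case: X_completion => _ norm_iota _.
rewrite -lte_fin norm_iota// => /ereal_inf_lt[_ [eta [eta0 etaE] <-]].
rewrite lte_fin => etaxi; apply: le_trans etaE.
by apply: (le_energy mp p1 mV v0_gt0 v0V) => //; [exact: Cc_infty_C1|exact: ltW].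
Qed.

Lemma iota_le f xi : f \in Cc -> 0 < xi -> (energy p V f xi <= 1)%E -> `|iota f| <= xi.
Proof.
move=> Cf xi0 fE; case: X_completion => _ norm_iota _.
by rewrite -lee_fin norm_iota//; apply: ereal_inf_lbound; exists xi.
Qed.

Lemma iota_gauge f xi : f \in Cc -> `|iota f| < xi -> gauge mu V p f xi.
Proof.
move=> Cf fxi; apply: (energy_gauge mp mV v0_gt0 v0V).
  exact: Cc_infty_C1.
exact: iota_energy.
Qed.

Lemma test_function_approx z (eps : R) : 0 < eps -> exists2 f, f \in Cc & `|iota f - z| < eps.
Proof.
move=> eps0; case: X_completion => _ _ dense_iota.
have [|w [zw [f Cf fw]]] := dense_iota (ball z eps) _ (ball_open z eps).
  by exists z; exact: ballxx.
exists f; first exact/mem_set.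
by rewrite fw; move: zw; rewrite -ball_normE /= distrC.
Qed.

Lemma Cc_measurable f : f \in Cc -> measurable_fun setT f.
Proof. by move=> Cf; apply: is_C1_measurable; exact: Cc_infty_C1. Qed.

(* [u] is the function identified with [z], characterized by the distances of
   [u] and of [z] to the test functions. *)
Definition represents z u : Prop := measurable_fun setT u /\
  forall f xi, f \in Cc -> `|iota f - z| < xi -> gauge mu V p (fun x => f x - u x) xi.

Definition rapidly_approximates (phi : nat -> RN -> R) z : Prop :=
  forall n, phi n \in Cc /\ `|iota (phi n) - z| < delta n.

Lemma exists_rapidly_approximates z : exists phi, rapidly_approximates phi z.
Proof.
have H n : exists f, f \in Cc /\ `|iota f - z| < delta n.
  by have [f Cf fz] := test_function_approx z (delta_gt0 n); exists f.
by have [phi phiP] := choice H; exists phi.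
Qed.

Lemma rapidly_approximates_dist phi z m n : rapidly_approximates phi z ->
  (n <= m)%N -> `|iota (fun x => phi n x - phi m x)| < 2 * delta n.
Proof.
move=> phiz nm; have [Cn hn] := phiz n; have [Cm hm] := phiz m.
rewrite iotaB//; apply: le_lt_trans (ler_distD z _ _) _.
rewrite mulr_natl mulr2n ltrD//.
by rewrite distrC (lt_le_trans hm)// delta_le.
Qed.

Lemma rapid_ae_cvg (w : nat -> RN -> R) (C : R) : 0 < C ->
  (forall n, measurable_fun setT (w n)) ->
  (forall n, gauge mu (cst 1) p (fun x => w n x - w n.+1 x) (C * delta n)) ->
  exists2 u : RN -> R, measurable_fun setT u &
    {ae mu, forall x, w n x @[n --> \oo] --> u x}.
Proof.
move=> C0 mw gw; apply: (ae_cvg_summable (B := @cube R N)) => //.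
- exact: measurable_cube.
- exact: bigcup_cube.
move=> k; exists (C * (fine (mu (cube k)) + 1)).
  by rewrite mulr_ge0 ?(ltW C0)// addr_ge0// fine_ge0.
apply: nearW => n.
have mD : measurable_fun setT (fun x => w n x - w n.+1 x) by exact: measurable_funB.
have Cd0 : 0 < C * delta n by rewrite mulr_gt0.
have -> : (\int[mu]_(x in cube k) `|w n.+1 x - w n x|%:E =
    \int[mu]_(x in cube k) `|w n (x + 0) - w n.+1 (x + 0)|%:E)%E.
  by apply: eq_integral => x _; rewrite addr0 distrC.
apply: le_trans (gauge_local 0 mp p1 mD Cd0 (@measurable_cube R N k) (gw n)) _.
by rewrite mulrAC -/(delta n) (EFinM _ (_ + 1)) EFinD fineK// ge0_fin_numE// cube_lty.
Qed.

Lemma rapid_gauge phi z m n : rapidly_approximates phi z -> (n <= m)%N ->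
  gauge mu V p (fun x => phi n x - phi m x) (2 * delta n).
Proof.
move=> phiz nm; apply: iota_gauge; last exact: rapidly_approximates_dist phiz nm.
by apply: Cc_inftyB; [exact: (phiz n).1|exact: (phiz m).1].
Qed.

(** For a test function [f] at distance less than [xi] from [z], the strict inequality leaves room
    for [delta n], so f - phi n has gauge [xi] for large [n]; Fatou's lemma passes this to f - u. *)
Lemma rapidly_approximates_cvg phi z : rapidly_approximates phi z ->
  exists2 u, represents z u & {ae mu, forall x, phi n x @[n --> \oo] --> u x}.
Proof.
move=> phiz; have mphi n : measurable_fun setT (phi n).
  by apply: Cc_measurable; exact: (phiz n).1.
have [||n|u mu' phiu] := @rapid_ae_cvg phi (c0 * 2).
- by rewrite mulr_gt0.
- exact: mphi.
- rewrite -mulrA; apply: (gauge_weight_const mp p1 mV v0_gt0 v0V).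
  + exact: measurable_funB.
  + by rewrite mulr_gt0.
  + exact: rapid_gauge phiz _.
exists u => //; split => // f xi Cf fz.
have mf := Cc_measurable Cf.
have xi0 : 0 < xi by exact: le_lt_trans fz.
apply: (@wmod_cvg _ _ _ mu V p mV mp V0 p1 (fun n x => (f x - phi n x) / xi)).
- by move=> n; apply: measurable_funM => //; exact: measurable_funB.
- by apply: measurable_funM => //; exact: measurable_funB.
- apply: filterS phiu => x phiux; apply: cvgM; last exact: cvg_cst.
  by apply: cvgB => //; exact: cvg_cst.
have : \forall n \near \oo, delta n < xi - `|iota f - z|.
  by move/cvgr_lt : delta_cvg0; apply; rewrite subr_gt0.
apply: filterS => n dn; apply: iota_gauge.
  by apply: Cc_inftyB => //; exact: (phiz n).1.
rewrite iotaB ?(phiz n).1//; apply: le_lt_trans (ler_distD z _ _) _.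
rewrite -ltrBrDl distrC (lt_trans _ dn)//; exact: (phiz n).2.
Qed.

Lemma exists_represents z : exists u, represents z u.
Proof.
have [phi phiz] := exists_rapidly_approximates z.
by have [u zu _] := rapidly_approximates_cvg phiz; exists u.
Qed.

Lemma represents_gauge z u xi : represents z u -> `|z| < xi -> gauge mu V p u xi.
Proof.
move=> [mu' zu] zxi; have xi0 : 0 < xi by exact: le_lt_trans zxi.
have := zu _ xi (Cc_infty0 N); rewrite iota0 sub0r normrN => /(_ zxi).
apply: le_gauge => //; first by apply: measurable_funB.
by apply: aeW => x; rewrite sub0r normrN.
Qed.

(** With test functions f near y and g near z, the difference is a (f - u) + (g - v) - (a f + g -
    w), and a f + g is close to a y + z. The gauge of the difference is thus arbitrarily small. *)
Lemma represents_lin (a : R) y z u v w :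
  represents y u -> represents z v -> represents (a *: y + z) w ->
  {ae mu, forall x, w x = a * u x + v x}.
Proof.
move=> [mu' yu] [mv zv] [mw yzw].
have mlin f g : measurable_fun setT f -> measurable_fun setT g ->
    measurable_fun setT (fun x => a * f x + g x).
  by move=> mf mg; apply: measurable_funD => //; exact: measurable_funM.
suff : {ae mu, forall x, w x - (a * u x + v x) = 0}.
  by apply: filterS => x /eqP; rewrite subr_eq0 => /eqP.
apply: (gauge_ae_eq0 mV mp V0 p1) => //.
  by apply: measurable_funB => //; exact: mlin.
(* Approximating within [eta], each of the three terms has gauge at most A eta = xi / 3: the factor
   |a| + 1 covers multiplication by [a] as well as the sum of the two errors. *)
move=> xi xi0; pose A := `|a| + 1.
have A0 : 0 < A by rewrite ltr_wpDl.
have A1 : 1 <= A by rewrite lerDr.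
pose eta := xi / 3 / A.
have eta0 : 0 < eta by rewrite !divr_gt0.
have Aeta : A * eta = xi / 3 by rewrite /eta mulrC divfK ?gt_eqF.
have [f Cf fy] := test_function_approx y eta0; have [g Cg gz] := test_function_approx z eta0.
have mf := Cc_measurable Cf; have mg := Cc_measurable Cg.
have g1 : gauge mu V p (fun x => a * (f x - u x)) (A * eta).
  apply: (gaugeM (xi := eta) mV mp V0 p1) => //.
  - exact: measurable_funB.
  - exact: yu.
  - by rewrite ler_wpM2r ?(ltW eta0)// lerDl.
  - by rewrite mulr_gt0.
have mgv : measurable_fun setT (fun x => g x - v x) by exact: measurable_funB.
have etaA : eta <= A * eta by rewrite ler_peMl// ltW.
have g2 : gauge mu V p (fun x => g x - v x) (A * eta).
  exact: (le_gauge mV mp V0 p1 mgv mgv eta0 etaA (aeW _ (fun=> lexx _)) (zv g eta Cg gz)).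
have g3 : gauge mu V p (fun x => (a * f x + g x) - w x) (A * eta).
  apply: yzw; first exact: Cc_infty_lin.
  rewrite iota_lin// opprD addrACA -scalerBr.
  apply: le_lt_trans (ler_normD _ _) _; rewrite normrZ mulrDl mul1r.
  by apply: ler_ltD => //; rewrite ler_wpM2l// ltW.
have mfu : measurable_fun setT (fun x => a * (f x - u x)).
  by apply: measurable_funM => //; exact: measurable_funB.
have mfgw : measurable_fun setT (fun x => (a * f x + g x) - w x).
  by apply: measurable_funB => //; exact: mlin.
have Aeta0 : 0 < A * eta by rewrite mulr_gt0.
have g3' : gauge mu V p (fun x => - ((a * f x + g x) - w x)) (A * eta).
  apply: (le_gauge mV mp V0 p1 (v := fun x => (a * f x + g x) - w x) _ _ _ _ _ g3) => //.
    by apply: measurableT_comp.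
  by apply: aeW => x; rewrite normrN.
have g12 := gaugeD mV mp V0 p1 mfu mgv Aeta0 Aeta0 g1 g2.
have mfugv : measurable_fun setT (fun x => a * (f x - u x) + (g x - v x)).
  exact: measurable_funD.
have mN : measurable_fun setT (fun x => - ((a * f x + g x) - w x)).
  exact: measurableT_comp.
have -> : (fun x => w x - (a * u x + v x)) =
    (fun x => a * (f x - u x) + (g x - v x) + - ((a * f x + g x) - w x)).
  by apply/funext => x; ring.
have -> : xi = A * eta + A * eta + A * eta by rewrite Aeta; field.
exact: (gaugeD mV mp V0 p1 mfugv mN (addr_gt0 Aeta0 Aeta0) Aeta0 g12 g3').
Qed.

(** Linearity with coefficient 0, since 0 z + z = z. *)
Lemma represents_unique z u v : represents z u -> represents z v ->
  {ae mu, forall x, u x = v x}.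
Proof.
move=> zu zv; have zu' : represents (0 *: z + z) u by rewrite scale0r add0r.
by apply: filterS (represents_lin zu zv zu') => x ->; rewrite mul0r add0r.
Qed.

Let derive_sub f g x i : f \in Cc -> g \in Cc ->
  'D_(e i) (fun y => f y - g y) x = 'D_(e i) f x - 'D_(e i) g x.
Proof.
move=> /Cc_infty_C1[_ /(_ i)[df _]] /Cc_infty_C1[_ /(_ i)[dg _]].
exact: deriveB.
Qed.

Let rapid_gauge_derive phi z i m n : rapidly_approximates phi z -> (n <= m)%N ->
  gauge mu (cst 1) p (fun x => 'D_(e i) (phi n) x - 'D_(e i) (phi m) x) (2 * delta n).
Proof.
move=> phiz nm; have Cn := (phiz n).1; have Cm := (phiz m).1.
rewrite (_ : (fun x => _) = (fun x => 'D_(e i) (fun y => phi n y - phi m y) x)); last first.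
  by apply/funext => x; rewrite derive_sub.
apply: (energy_gauge_derive mp p1 mV v0_gt0 v0V).
  by apply: Cc_infty_C1; exact: Cc_inftyB.
by apply: iota_energy; [exact: Cc_inftyB|exact: rapidly_approximates_dist phiz nm].
Qed.

(** The derivatives converge almost everywhere to some [g], and Fatou's lemma turns their Cauchy
    estimate into a gauge bound for the distance to [g]; closability then gives g = 0. *)
Let rapid_derive_cvg0 phi z i : rapidly_approximates phi z ->
  {ae mu, forall x, phi n x @[n --> \oo] --> 0} ->
  {ae mu, forall x, 'D_(e i) (phi n) x @[n --> \oo] --> 0}.
Proof.
move=> phiz phi0; have C1phi n : is_Ck 1 (phi n) by apply: Cc_infty_C1; exact: (phiz n).1.
have mdphi n : measurable_fun setT (fun x => 'D_(e i) (phi n) x).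
  exact: is_C1_measurable_derive.
have [||n|g mg dphig] := @rapid_ae_cvg (fun n x => 'D_(e i) (phi n) x) 2.
- by [].
- exact: mdphi.
- exact: rapid_gauge_derive phiz _.
have gg n : gauge mu (cst 1) p (fun x => 'D_(e i) (phi n) x - g x) (2 * delta n).
  apply: (@wmod_cvg _ _ _ mu (cst 1) p _ mp _ p1
    (fun m x => ('D_(e i) (phi n) x - 'D_(e i) (phi m) x) / (2 * delta n))) => //.
  - by move=> m; apply: measurable_funM => //; exact: measurable_funB.
  - by apply: measurable_funM => //; exact: measurable_funB.
  - apply: filterS dphig => x dphigx; apply: cvgM; last exact: cvg_cst.
    by apply: cvgB => //; exact: cvg_cst.
  - by exists n => // m /= nm; exact: rapid_gauge_derive phiz nm.
have g0 : {ae mu, forall x, g x = 0}.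
  apply: (derive_closable mp p1 C1phi mg _ _ phi0 gg).
    by move=> n; rewrite mulr_gt0.
  by rewrite -[X in _ --> X](mulr0 2); apply: cvgM => //; exact: cvg_cst.
by apply: filterS2 dphig g0 => x + gx; rewrite gx.
Qed.

(** The approximating functions and their gradients tend to 0 almost everywhere. Letting m tend to
    infinity in the bound for phi n - phi m shows that phi n itself has norm at most 2 delta n,
    whence |z| <= 3 delta n. *)
Lemma represents_eq0 z u : represents z u -> {ae mu, forall x, u x = 0} -> z = 0.
Proof.
move=> zu u0; have [phi phiz] := exists_rapidly_approximates z.
have C1phi n : is_Ck 1 (phi n) by apply: Cc_infty_C1; exact: (phiz n).1.
have [u' zu' phiu'] := rapidly_approximates_cvg phiz.
have phi0 : {ae mu, forall x, phi n x @[n --> \oo] --> 0}.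
  have u'u := represents_unique zu' zu.
  by apply: filterS3 phiu' u'u u0 => x + u'x ux; rewrite u'x ux.
have dphi0 i := rapid_derive_cvg0 i phiz phi0.
have phi_le n : `|iota (phi n)| <= 2 * delta n.
  apply: iota_le; [exact: (phiz n).1|by rewrite mulr_gt0|].
  apply: (energy_cvg mp p1 mV v0_gt0 v0V (f := fun m x => phi n x - phi m x)) => //.
  - by move=> m; apply: Cc_infty_C1; apply: Cc_inftyB; [exact: (phiz n).1|exact: (phiz m).1].
  - apply: filterS phi0 => x phix; rewrite -[X in _ --> X]subr0.
    by apply: cvgB => //; exact: cvg_cst.
  - move=> i; apply: filterS (dphi0 i) => x dphix; rewrite -[X in _ --> X]subr0.
    under eq_fun do rewrite derive_sub ?(phiz _).1//.
    by apply: cvgB => //; exact: cvg_cst.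
  exists n => // m /= nm; apply: iota_energy.
    by apply: Cc_inftyB; [exact: (phiz n).1|exact: (phiz m).1].
  exact: rapidly_approximates_dist phiz nm.
apply/eqP; rewrite -normr_le0; apply/ler_addgt0Pr => eps eps0; rewrite add0r.
have : \forall n \near \oo, delta n < eps / 3.
  by move/cvgr_lt : delta_cvg0; apply; rewrite divr_gt0.
move=> [n _ /(_ n (leqnn n)) /= dn].
rewrite (_ : z = iota (phi n) - (iota (phi n) - z)); last by rewrite opprB addrC subrK.
apply: (le_trans (ler_normB _ _)).
have := phi_le n; have := (phiz n).2; move: dn.
by move: (delta n) `|iota (phi n)| `|iota (phi n) - z| => a b c; lra.
Qed.

Lemma represents_identified z u : represents z u -> identified p iota z u.
Proof.
move=> zu; have [mu' zu'] := zu; split.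
  rewrite inE; split => //; rewrite modularE.
  have g1 : gauge mu (cst 1) p u (c0 * (`|z| + 1)).
    apply: (gauge_weight_const mp p1 mV v0_gt0 v0V) => //.
    by apply: represents_gauge zu _; rewrite ltrDl.
  have K0 : 0 < c0 * (`|z| + 1) by rewrite mulr_gt0// ltr_wpDl.
  apply: le_lt_trans (ltry _).
  exact: (gauge_wmod_le (@measurable_cst _ _ _ _ _ _) mp (fun=> ler01) p1 mu' K0 pP g1).
have [phi phiz] := exists_rapidly_approximates z.
exists phi; split; first by move=> n; exact: (phiz n).1.
  apply/cvgrPdist_lt => eps eps0.
  have : \forall n \near \oo, delta n < eps by move/cvgr_lt : delta_cvg0; apply.
  by apply: filterS => n dn; rewrite distrC (lt_trans (phiz n).2).
apply: luxemburg_cvg0 => eps eps0.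
have : \forall n \near \oo, delta n < eps / c0.
  by move/cvgr_lt : delta_cvg0; apply; rewrite divr_gt0.
apply: filterS => n dn.
have mD : measurable_fun setT (phi n \- u).
  by apply: measurable_funB => //; apply: Cc_measurable; exact: (phiz n).1.
apply: (luxemburg_le mp mp mD) => //; first exact: aeW.
rewrite -[eps](@divfK _ c0) ?gt_eqF// mulrC.
apply: (gauge_weight_const mp p1 mV v0_gt0 v0V) => //; first by rewrite divr_gt0.
by apply: zu'; [exact: (phiz n).1|exact: lt_trans (phiz n).2 dn].
Qed.

End representatives.

(** * The embedding *)

Section embedding.
Context {R : realType} (N : nat).
Local Notation RN := 'rV[R]_N.
Local Notation mu := (@lebesgue_rV R N).
Local Notation e := (@evec R N).
Variables (p q q' V : RN -> R) (v0 d P : R).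
Hypotheses (mp : measurable_fun setT p) (mq : measurable_fun setT q).
Hypotheses (mq' : measurable_fun setT q') (q1 : forall x, 1 <= q' x).
Hypotheses (d_gt0 : 0 < d) (qp : forall x, q' x + d <= p x).
Hypotheses (pP : forall x, p x <= P) (qq' : {ae mu, forall x, q x = q' x}).
Hypotheses (mV : measurable_fun setT V) (v0_gt0 : 0 < v0).
Hypothesis v0V : forall x, v0 <= V x.
Hypothesis V_int : mu.-integrable setT
  (fun x => (V x `^ (- (q' x / (p x - q' x))))%:E).
Variables (X : completeNormedModType R) (iota : (RN -> R) -> X).
Hypothesis X_completion : is_completion p V iota.
Implicit Types (f g u v : RN -> R) (xi : R) (z : X) (x : RN).

Local Notation K := (embedding_const mu p q' V).

Let p1 x : 1 <= p x.
Proof. by apply: le_trans (q1 x) _; apply: le_trans (qp x); rewrite lerDl ltW. Qed.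

Let q'P x : q' x <= P.
Proof. by apply: le_trans (pP x); apply: le_trans (qp x); rewrite lerDl ltW. Qed.

Let V_gt0 x : 0 < V x. Proof. exact: lt_le_trans (v0V x). Qed.

Let V0 x : 0 <= V x. Proof. exact: ltW. Qed.

Let K_gt0 : 0 < K. Proof. by apply: lt_le_trans (embedding_const_ge1 _ _ _ _). Qed.

Let represents := represents p V iota.

Lemma gauge_Lvar u xi : measurable_fun setT u -> 0 < xi ->
  gauge mu (cst 1) q' u xi -> u \in Lvar q.
Proof.
move=> mu' xi0 gu; rewrite inE; split => //.
rewrite (modular_ae_eq mq mq' mu' qq') modularE; apply: le_lt_trans (ltry _).
exact: (gauge_wmod_le (@measurable_cst _ _ _ _ _ _) mq' (fun=> ler01) q1 mu' xi0 q'P gu).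
Qed.

Lemma gauge_V_q u xi : measurable_fun setT u -> 0 < xi ->
  gauge mu V p u xi -> gauge mu (cst 1) q' u (K * xi).
Proof. exact: (gauge_embedding mp mq' mV V_gt0 q1 d_gt0 qp pP V_int). Qed.

(** By linearity J y - J z equals J (y - z) almost everywhere, whose gauge is controlled by the norm
    of y - z. *)
Lemma lin_gauge (J : X -> RN -> R) : (forall z, represents z (J z)) ->
  forall y z xi, `|y - z| < xi -> gauge mu V p (J y \- J z) xi.
Proof.
move=> HJ y z xi yz; have xi0 : 0 < xi by exact: le_lt_trans yz.
have mJ w := (HJ w).1.
have yzE : -1 *: z + y = y - z by rewrite scaleN1r addrC.
have rep : represents (-1 *: z + y) (J (y - z)) by rewrite yzE.
have Jlin := represents_lin mp p1 mV v0_gt0 v0V X_completion (HJ z) (HJ y) rep.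
apply: (le_gauge mV mp V0 p1 (v := J (y - z)) _ _ xi0 (lexx xi)) => //.
- exact: measurable_funB.
- by apply: filterS Jlin => x ->; rewrite mulN1r addrC.
- exact: (represents_gauge mp p1 mV v0_gt0 v0V X_completion (HJ (y - z)) yz).
Qed.

Lemma represents_continuous_embedding (J : X -> RN -> R) :
  (forall z, represents z (J z)) -> continuous_embedding q J.
Proof.
move=> HJ; have mJ w : measurable_fun setT (J w) := (HJ w).1.
split.
- move=> z; have z1 : `|z| < `|z| + 1 by rewrite ltrDl.
  have z0 : 0 < `|z| + 1 by rewrite ltr_wpDl.
  apply: (gauge_Lvar (xi := K * (`|z| + 1))) => //; first by rewrite mulr_gt0.
  apply: gauge_V_q => //.
  exact: (represents_gauge mp p1 mV v0_gt0 v0V X_completion (HJ z) z1).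
- move=> a y z.
  exact: (represents_lin mp p1 mV v0_gt0 v0V X_completion (HJ y) (HJ z) (HJ _)).
- move=> y z yz; apply/eqP; rewrite -subr_eq0; apply/eqP.
  apply: (represents_eq0 mp p1 mV v0_gt0 v0V X_completion (HJ (y - z))).
  have yzE : -1 *: z + y = y - z by rewrite scaleN1r addrC.
  have rep : represents (-1 *: z + y) (J (y - z)) by rewrite yzE.
  have Jlin := represents_lin mp p1 mV v0_gt0 v0V X_completion (HJ z) (HJ y) rep.
  by apply: filterS2 Jlin yz => x -> ->; rewrite mulN1r addNr.
- move=> z; apply: luxemburg_cvg0 => eps eps0.
  have epsK : 0 < eps / K by rewrite divr_gt0.
  have : \forall y \near z, `|y - z| < eps / K.
    by apply/nbhs_normP; exists (eps / K) => // y /=; rewrite distrC.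
  apply: filterS => y yz.
  have mD : measurable_fun setT (J y \- J z) by exact: measurable_funB.
  apply: (luxemburg_le mq mq' mD qq') => //.
  have -> : eps = K * (eps / K) by rewrite [RHS]mulrC divfK// gt_eqF.
  exact: (gauge_V_q mD epsK (lin_gauge HJ yz)).
Qed.

(** Only test functions have the regularity needed for the translation estimate, so z n is replaced
    by a test function within 1/(n+1); the error made in L^q(x) tends to 0 by continuity of the
    embedding. *)
Lemma represents_compact_map (J : X -> RN -> R) :
  (forall z, represents z (J z)) -> compact_map q J.
Proof.
move=> HJ z [M zM]; have mJ w : measurable_fun setT (J w) := (HJ w).1.
have M0 : 0 <= M by rewrite (le_trans _ (zM 0%N)).
have Happ n : exists f, f \in @Cc_infty R N /\ `|iota f - z n| < n.+1%:R^-1.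
  have eps0 : 0 < n.+1%:R^-1 :> R by rewrite invr_gt0.
  by have [f Cf fz] := test_function_approx X_completion (z n) eps0; exists f.
have [phi phiz] := choice Happ.
have Cphi n := (phiz n).1.
have C1phi n : is_Ck 1 (phi n) := Cc_infty_C1 (Cphi n).
have mphi n := Cc_measurable (Cphi n).
(* The approximation error is at most 1, so 2 leaves the strict inequality that [iota_gauge] and
   [iota_energy] require. *)
pose M1 := M + 2.
have M10 : 0 < M1 by rewrite ltr_wpDl.
have iota_lt n : `|iota (phi n)| < M1.
  rewrite -[iota _](subrK (z n)); apply: le_lt_trans (ler_normD _ _) _.
  rewrite /M1 addrC; apply: ler_ltD => //.
  apply: lt_trans (phiz n).2 _; apply: (@le_lt_trans _ _ 1); last by rewrite ltr1n.
  by rewrite invf_le1// ler1n.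
have gV n := iota_gauge mp p1 mV v0_gt0 v0V X_completion (Cphi n) (iota_lt n).
have iE n := iota_energy mp p1 mV v0_gt0 v0V X_completion (Cphi n) (iota_lt n).
pose c0 := weight_const v0.
have c01 : 1 <= c0 by exact: weight_const_ge1.
have c0M : M1 <= c0 * M1 by rewrite ler_peMl// ltW.
have cM0 : 0 < c0 * M1 by exact: lt_le_trans c0M.
have g1 n : gauge mu (cst 1) p (phi n) (c0 * M1).
  exact: (gauge_weight_const mp p1 mV v0_gt0 v0V (mphi n) M10 (gV n)).
have gd n i : gauge mu (cst 1) p (fun x => 'D_(e i) (phi n) x) (c0 * M1).
  have mdphi : measurable_fun setT (fun x => 'D_(e i) (phi n) x).
    exact: is_C1_measurable_derive.
  apply: (le_gauge (@measurable_cst _ _ _ _ _ _) mp (fun=> ler01) p1 mdphi mdphi M10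
    c0M (aeW _ (fun=> lexx _))).
  exact: (energy_gauge_derive mp p1 mV v0_gt0 v0V i (C1phi n) (iE n)).
have [s [s_incr [v mv phiv]]] := rellich_ae mp p1 cM0 C1phi g1 gd.
exists s; split => //.
(* The limit inherits the bound by Fatou's lemma; thus phi (s n) - v is bounded with weight [V], as
   [gauge_embedding_cvg0] demands. *)
have gVv : gauge mu V p v M1.
  apply: (@wmod_cvg _ _ _ mu V p mV mp V0 p1 (fun n x => phi (s n) x / M1)).
  - by move=> n; exact: measurable_funM.
  - exact: measurable_funM.
  - by apply: filterS phiv => x phivx; apply: cvgM => //; exact: cvg_cst.
  - by apply: nearW => n; exact: gV.
have KM0 : 0 < K * M1 by rewrite mulr_gt0.
exists v.
  by apply: (gauge_Lvar mv KM0); exact: gauge_V_q.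
apply: luxemburg_cvg0 => eps eps0.
have eps2 : 0 < eps / 2 by rewrite divr_gt0.
have mB n : measurable_fun setT (fun x => phi (s n) x - v x) by exact: measurable_funB.
have mvN : measurable_fun setT (fun x => - v x) by exact: measurableT_comp.
have gVN : gauge mu V p (fun x => - v x) M1.
  apply: (le_gauge mV mp V0 p1 mvN mv M10 (lexx _) _ gVv).
  by apply: aeW => x; rewrite normrN.
have gB n : gauge mu V p (fun x => phi (s n) x - v x) (M1 + M1).
  exact: (gaugeD mV mp V0 p1 (mphi (s n)) mvN M10 M10 (gV (s n)) gVN).
have cv0 : {ae mu, forall x, phi (s n) x - v x @[n --> \oo] --> 0}.
  apply: filterS phiv => x phivx; rewrite -[X in _ --> X](subrr (v x)).
  by apply: cvgB => //; exact: cvg_cst.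
have near1 := gauge_embedding_cvg0 mp mq' mV V_gt0 q1 d_gt0 qp pP V_int
  mB (addr_gt0 M10 M10) gB cv0 eps2.
have epsK : 0 < eps / 2 / K by rewrite divr_gt0.
have near2 : \forall n \near \oo, n.+1%:R^-1 < eps / 2 / K.
  exact: (near_infty_natSinv_lt (PosNum epsK)).
apply: filterS2 near1 near2 => n hn1 hn2.
have mD : measurable_fun setT (J (z (s n)) \- v) by exact: measurable_funB.
apply: (luxemburg_le mq mq' mD qq' eps0).
have mJphi : measurable_fun setT (fun x => phi (s n) x - J (z (s n)) x).
  exact: measurable_funB.
(* A strictly increasing [s] satisfies s n >= n. *)
have sn : (s n).+1%:R^-1 <= n.+1%:R^-1 :> R.
  rewrite lef_pV2 ?posrE// ler_nat ltnS.
  elim: n {hn1 hn2 mD mJphi} => [//|n IH]; exact: leq_ltn_trans IH (s_incr _ _ (ltnSn n)).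
have hJ : gauge mu (cst 1) q' (fun x => phi (s n) x - J (z (s n)) x) (eps / 2).
  have -> : eps / 2 = K * (eps / 2 / K) by rewrite [RHS]mulrC divfK// gt_eqF.
  apply: (gauge_V_q mJphi epsK).
  apply: (HJ (z (s n))).2; first exact: Cphi.
  by apply: lt_trans (phiz (s n)).2 _; exact: le_lt_trans hn2.
have mN : measurable_fun setT (fun x => - (phi (s n) x - J (z (s n)) x)).
  exact: measurableT_comp.
have hJN : gauge mu (cst 1) q' (fun x => - (phi (s n) x - J (z (s n)) x)) (eps / 2).
  apply: (le_gauge (@measurable_cst _ _ _ _ _ _) mq' (fun=> ler01) q1 mN mJphi eps2
    (lexx _) _ hJ).
  by apply: aeW => x; rewrite normrN.
have -> : J (z (s n)) \- v =
    (fun x => (phi (s n) x - v x) + - (phi (s n) x - J (z (s n)) x)).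
  by apply/funext => x /=; ring.
rewrite [eps]splitr.
exact: (gaugeD (@measurable_cst _ _ _ _ _ _) mq' (fun=> ler01) q1 (mB n) mN eps2 eps2 hn1 hJN).
Qed.

End embedding.

(** * Pointwise bounds from essential ones *)

Section essential_bounds.
Context {R : realType} (N : nat).
Local Notation RN := 'rV[R]_N.
Local Notation mu := (@lebesgue_rV R N).
Implicit Types (a b f : RN -> R).

Let ex_lbound (y : \bar R) : (0 < y)%E -> exists2 d : R, 0 < d & (d%:E <= y)%E.
Proof.
case: y => [y| |] y0; [by exists y|by exists 1 => //; exact: leey|by []].
Qed.

Lemma ess_ll_lbound a b : ess_ll a b ->
  exists2 d : R, 0 < d & {ae mu, forall x, a x + d <= b x}.
Proof.
move=> /ex_lbound[d d0 /ess_infP dab]; exists d => //.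
by apply: filterS dab => x /=; rewrite lee_fin lerBrDl.
Qed.

Lemma inf_RN_lbound f : (0 < inf_RN f)%E -> exists2 d : R, 0 < d & forall x, d <= f x.
Proof.
move=> /ex_lbound[d d0 df]; exists d => // x; rewrite -lee_fin.
by apply: le_trans df _; apply: ereal_inf_lbound; exists x.
Qed.

(** The set where f < c is open, and a nonempty open set has positive measure. *)
Lemma continuous_ae_ge f (c : R) : continuous f -> {ae mu, forall x, c <= f x} ->
  forall x, c <= f x.
Proof.
move=> cf [A [mA A0 fA]] x; rewrite leNgt; apply/negP => fx.
have oU : open (f @^-1` [set y | y < c]).
  by have /continuousP := cf; apply; exact: open_lt.
have U0 := lebesgue_rV_open_gt0 oU (ex_intro _ x fx).
have : (lebesgue_rV N (f @^-1` [set y | (y < c)%R]) <= lebesgue_rV N A)%E.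
  apply: le_measure; rewrite ?inE//; first exact: open_measurable_rV.
  by move=> y /= fy; apply: fA => /=; apply/negP; rewrite -ltNge.
by rewrite A0 leNgt U0.
Qed.

Lemma lipschitz_continuous f : lipschitz f -> continuous f.
Proof.
move=> [M [_ fM]] x; apply/(@cvgrPdist_lt _ _ _ (nbhs x) (nbhs_filter x)) => eps eps0.
(* [lipschitz] grants the estimate for all constants beyond some [M] of unknown sign; [|M| + 1] is
   such a constant and is positive. *)
have M0 : 0 < `|M| + 1 by rewrite ltr_wpDl.
have MM : M < `|M| + 1 by rewrite ltr_pwDr// ler_norm.
have h0 : 0 < eps / (`|M| + 1) by rewrite divr_gt0.
near=> y.
apply: le_lt_trans (fM _ MM (x, y) (conj I I)) _ => /=.
rewrite -ltr_pdivlMl// mulrC; near: y.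
apply/nbhs_ballP; exists (eps / (`|M| + 1)) => // y.
by rewrite -ball_normE.
Unshelve. all: by end_near. Qed.

End essential_bounds.

Theorem lemma2p2 (R : realType) (N : nat) (p q V : 'rV[R]_N -> R)
    (X : completeNormedModType R) (iota : ('rV[R]_N -> R) -> X)
    (p_lipschitz : lipschitz p)
    (q_Linfty : q \in Lfun (@lebesgue_rV R N) +oo%E)
    (one_ll_q : ess_ll (cst 1) q) (q_ll_p : ess_ll q p)
    (p_ll_N : ll p (cst N%:R))
    (V_continuous : continuous V) (V_inf_gt0 : (0 < inf_RN V)%E)
    (V_integrable : (@lebesgue_rV R N).-integrable setT
       (fun x => (V x `^ (- (q x / (p x - q x))))%:E))
    (X_completion : is_completion p V iota) :
  exists J : X -> 'rV[R]_N -> R,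
    [/\ forall z, identified p iota z (J z),
        continuous_embedding q J &
        compact_map q J].
Proof.
have [d1 d10 q_ge] := ess_ll_lbound one_ll_q.
have [d2 d20 p_ge] := ess_ll_lbound q_ll_p.
have [dN dN0 pN] := inf_RN_lbound p_ll_N.
have [v0 v00 v0V] := inf_RN_lbound V_inf_gt0.
have cp : continuous p by exact: lipschitz_continuous.
have mp := continuous_measurable_rV cp.
have mV := continuous_measurable_rV V_continuous.
have mq : measurable_fun setT q by have := set_mem (sub_Lfun_mfun q_Linfty).
pose d := Num.min d1 d2.
have d0 : 0 < d by rewrite lt_min d10.
(* The two essential gaps give this bound almost everywhere, and continuity of [p] gives it
   everywhere; it leaves room for the truncation of [q] between 1 and p - d. *)
have p_ge1 x : 1 + d + d <= p x.
  apply: (continuous_ae_ge cp); apply: filterS2 q_ge p_ge => y /= h1 h2.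
  apply: le_trans h2; rewrite lerD ?ge_min ?lexx ?orbT//.
  by apply: le_trans h1; rewrite lerD2l ge_min lexx.
(* Almost everywhere q lies between 1 and p - d, so the truncation changes it only on a null set. *)
pose q' x := Num.max 1 (Num.min (q x) (p x - d)).
have mq' : measurable_fun setT q'.
  apply: measurable_maxr => //; apply: measurable_minr => //.
  exact: measurable_funB.
have q'1 x : 1 <= q' x by rewrite le_max lexx.
have q'p x : q' x + d <= p x.
  rewrite -lerBrDr ge_max ge_min lexx orbT andbT lerBrDr.
  by apply: le_trans (p_ge1 x); rewrite lerDl ltW.
have qq' : {ae lebesgue_rV N, forall x, q x = q' x}.
  apply: filterS2 q_ge p_ge => x /= h1 h2; rewrite /q'.
  have qp : q x <= p x - d.
    by rewrite lerBrDr; apply: le_trans h2; rewrite lerD2l ge_min lexx orbT.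
  have q1 : 1 <= q x by apply: le_trans h1; rewrite lerDl ltW.
  by rewrite (min_idPl qp) (max_idPr q1).
have V_int : (@lebesgue_rV R N).-integrable setT
    (fun x => (V x `^ (- (q' x / (p x - q' x))))%:E).
  have [mVq intq] := integrableP _ _ _ V_integrable.
  have mVq' : measurable_fun setT
      (fun x => (V x `^ (- (q' x / (p x - q' x))))%:E).
    apply/measurable_EFinP; apply: measurable_powR2 => //.
    apply: measurableT_comp => //; apply: measurable_funM => //.
    (* The inverse is rewritten as a power so that [measurable_powR2] applies. *)
    rewrite (_ : (fun x => _) = (fun x => (p x - q' x) `^ (-1))); last first.
      apply/funext => x; rewrite powR_inv1// subr_ge0.
      by apply: le_trans (q'p x); rewrite lerDl ltW.
    by apply: measurable_powR2 => //; exact: measurable_funB.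
  apply/integrableP; split; first exact: mVq'.
  apply: le_lt_trans intq; rewrite le_eqVlt; apply/orP; left; apply/eqP.
  apply: ae_eq_integral => //.
  - exact: measurableT_comp.
  - exact: measurableT_comp.
  - by apply: filterS qq' => x -> _.
(* The dimension serves as the upper bound [P] of the exponents. *)
have pN' x : p x <= N%:R by rewrite -subr_ge0; apply: le_trans (pN x); exact: ltW.
have p1 x : 1 <= p x by apply: le_trans (p_ge1 x); rewrite -addrA lerDl addr_ge0 ?ltW.
have [J HJ] := choice (exists_represents mp p1 mV v00 v0V X_completion).
exists J; split.
- by move=> z; exact: (represents_identified mp p1 pN' mV v00 v0V X_completion (HJ z)).
- exact: (represents_continuous_embedding mp mq mq' q'1 d0 q'p pN' qq' mV v00 v0V
    V_int X_completion HJ).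
- exact: (represents_compact_map mp mq mq' q'1 d0 q'p pN' qq' mV v00 v0V
    V_int X_completion HJ).
Qed.
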